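(* Let $(M,g)$ be a closed (compact, without boundary), oriented smooth Riemannian manifold and let $v$ be a smooth vector field on $M$. Then the $v$-induced Hodge Laplacian $\Delta_v = d\delta_v+\delta_v d:\Omega^k(M)\to\Omega^k(M)$ is elliptic (for every degree $k$).
   Context: $\Omega^k(M)$ is the space of smooth differential $k$-forms on $M$, $d$ is the exterior derivative, and $\star$ is the Hodge star of $g$, defined by $\omega\wedge\star\eta=\langle\omega,\eta\rangle_g\,\mu_g$, where $\mu_g$ is the Riemannian volume form and $\langle\cdot,\cdot\rangle_g$ is the pointwise inner product on $k$-forms induced by $g$ (on decomposables, $\langle\omega_1\wedge\dots\wedge\omega_k,\eta_1\wedge\dots\wedge\eta_k\rangle_g=\det(g^{-1}(\omega_i,\eta_j))$). The codifferential on $k$-forms is $\delta=(-1)^k\star^{-1}d\star$. Let $v^\flat=g(v,\cdot)$, let $\iota_v$ be the interior product (zero on $0$-forms), and set $T_v=\mathrm{id}+v^\flat\wedge\iota_v:\Omega^k(M)\to\Omega^k(M)$, which is a pointwise invertible bundle map. The $v$-induced codifferential is $\delta_v=T_v^{-1}\delta T_v$; equivalently, $\delta_v=(-1)^k\star_v^{-1}d\star_v$ on $k$-forms with $\star_v=\star T_v$. *)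

(* Defs.v *)
From HB Require Import structures.
From mathcomp Require Import all_boot all_order all_algebra.
From mathcomp Require Import all_classical all_reals all_analysis.
Import Order.TTheory GRing.Theory Num.Theory.
Import numFieldNormedType.Exports.

Set Implicit Arguments.
Unset Strict Implicit.
Unset Printing Implicit Defensive.

Local Open Scope classical_set_scope.
Local Open Scope ring_scope.

(* An exterior form is given by its coefficients on the basis                 *)
(*   dx^I = dx^{i_1} /\ ... /\ dx^{i_k},  I = {i_1 < ... < i_k}.              *)
(* All degrees live in the one type exterior R n; homog k is the subspace of  *)
(* k-forms. Vectors and covectors are row vectors.                            *)

Notation exterior R n := {ffun {set 'I_n} -> R}.

Section ExteriorAlgebra.
Context {R : realType} {n : nat}.
Implicit Types (I J K : {set 'I_n}) (a b : exterior R n) (v w : 'rV[R]_n).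
Implicit Types (G A : 'M[R]_n) (k : nat).

Definition homog k : set (exterior R n) :=
  [set a : exterior R n | forall I : {set 'I_n}, #|I| != k -> a I = 0].

Definition ext_part k a : exterior R n :=
  [ffun I : {set 'I_n} => if #|I| == k then a I else 0].

(* dx^I /\ dx^J = (-1)^(inversions I J) dx^(I :|: J) for disjoint I and J *)
Definition inversions I J : nat :=
  #|[set ij : 'I_n * 'I_n |
      [&& ij.1 \in I, ij.2 \in J & (ij.2 < ij.1)%N]]%SET|.

Definition ext_wedge a b : exterior R n :=
  [ffun K : {set 'I_n} =>
    \sum_(I : {set 'I_n} | I \subset K)
       (-1) ^+ inversions I (K :\: I) * a I * b (K :\: I)].

Definition covector w : exterior R n :=
  [ffun I : {set 'I_n} => \sum_(i < n | I == [set i]%SET) w 0 i].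

(* If i is not in I, dx^i /\ dx^I = (-1)^(inversions [set i] I) dx^(i |: I). *)
Definition contraction v a : exterior R n :=
  [ffun I : {set 'I_n} =>
    \sum_(i < n | i \notin I)
       (-1) ^+ inversions [set i]%SET I * v 0 i * a (i |: I)].

(* The minor of A on rows I and columns J, both listed increasingly (0 when   *)
(* #|I| and #|J| differ).                                                     *)
Definition minor A I J : R :=
  match @eqP _ #|I| #|J| with
  | ReflectT e =>
      \det (mxsub (@enum_val _ (mem I)) (@enum_val _ (mem J) \o cast_ord e) A)
  | ReflectF _ => 0
  end.

(* With A i j = d_i tau^j, the pullback along tau is given by                 *)
(* tau^* dy^J = \sum_I det (d_i tau^j)_(i in I, j in J) dx^I.                 *)
Definition ext_pullback A a : exterior R n :=
  [ffun I : {set 'I_n} => \sum_(J : {set 'I_n}) minor A I J * a J].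

(* For the metric G i j = g(d_i, d_j), one has g^-1(dx^i, dx^j) = invmx G i j *)
(* and <dx^I, dx^J> = det (g^-1(dx^i, dx^j))_(i in I, j in J); different      *)
(* degrees are orthogonal.                                                    *)
Definition ext_inner G a b : R :=
  \sum_(I : {set 'I_n}) \sum_(J : {set 'I_n}) a I * b J * minor (invmx G) I J.

(* The volume form in positively oriented coordinates *)
Definition vol_form G : exterior R n :=
  [ffun K : {set 'I_n} => Num.sqrt (\det G) *+ (K == [set: 'I_n]%SET)].

(* The unique form whose component of degree n - k is, for each k, the Hodge  *)
(* dual of the degree k component of b.                                       *)
Definition hodge G b : exterior R n :=
  xget 0 [set z : exterior R n |
    forall (k : 'I_n.+1) (a : exterior R n), homog k a ->
      ext_wedge a (ext_part (n - k) z)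
      = ext_inner G a (ext_part k b) *: vol_form G].

Definition hodge_inv G : exterior R n -> exterior R n :=
  'pinv_(fun=> 0) [set: exterior R n] (hodge G).

Definition flat G v : exterior R n := covector (v *m G).

Definition Tmap G v a : exterior R n :=
  a + ext_wedge (flat G v) (contraction v a).

Definition Tmap_inv G v : exterior R n -> exterior R n :=
  'pinv_(fun=> 0) [set: exterior R n] (Tmap G v).

End ExteriorAlgebra.

Section Smooth.
Context {R : realType} {n : nat}.
Implicit Types (f : 'rV[R]_n -> R) (U : set 'rV[R]_n).

Definition partial (i : 'I_n) f : 'rV[R]_n -> R := fun p => 'D_('e_i) f p.

Definition partials (s : seq 'I_n) f : 'rV[R]_n -> R := foldr partial f s.

(* Meant for open U: partial derivatives of all orders exist and are          *)
(* (Frechet) differentiable, i.e. f is C^oo on U.                             *)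
Definition smooth_on U f :=
  forall (s : seq 'I_n) (p : 'rV[R]_n), U p -> differentiable (partials s f) p.

(* d (\sum_I w_I dx^I) = \sum_i \sum_I (d_i w_I) dx^i /\ dx^I *)
Definition ext_deriv (w : 'rV[R]_n -> exterior R n) (p : 'rV[R]_n) :
    exterior R n :=
  \sum_(i < n) ext_wedge (covector 'e_i)
    [ffun I : {set 'I_n} => partial i (fun q => w q I) p].

End Smooth.

Record chart (R : realType) (n : nat) (T : topologicalType) := Chart {
  cdom : set T;
  ccod : set 'rV[R]_n;
  coord : T -> 'rV[R]_n;
  param : 'rV[R]_n -> T;
  cdom_open : open cdom;
  ccod_open : open ccod;
  coord_in : forall x, cdom x -> ccod (coord x);
  param_in : forall p, ccod p -> cdom (param p);
  coordK : forall x, cdom x -> param (coord x) = x;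
  paramK : forall p, ccod p -> coord (param p) = p;
  coord_continuous : {within cdom, continuous coord};
  param_continuous : {within ccod, continuous param} }.

Section Transition.
Context {R : realType} {n : nat} {T : topologicalType}.
Implicit Types c : chart R n T.

Definition transition c (c' : chart R n T) : 'rV[R]_n -> 'rV[R]_n :=
  coord c' \o param c.

Definition overlap c (c' : chart R n T) : set 'rV[R]_n :=
  [set p | ccod c p /\ cdom c' (param c p)].

End Transition.

(* Boundaryless, as charts take values in open subsets of R^n *)
Record manifold (R : realType) (n : nat) := Manifold {
  carrier :> topologicalType;
  atlas : set (chart R n carrier);
  carrier_hausdorff : hausdorff_space carrier;
  carrier_second_countable : @second_countable carrier;
  atlas_cover : forall x : carrier, exists2 c, atlas c & cdom c x;
  atlas_smooth : forall c c', atlas c -> atlas c' -> forall j : 'I_n,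
    smooth_on (overlap c c') (fun p => transition c c' p 0 j) }.

(* The orientation of M is the one for which all charts of its atlas are      *)
(* positively oriented.                                                       *)
Definition oriented (R : realType) (n : nat) (M : manifold R n) :=
  forall c c' : chart R n M, atlas c -> atlas c' ->
    forall p, overlap c c' p -> 0 < \det (jacobian (transition c c') p).

(* A tensor field is the family of its component functions in the charts of   *)
(* the atlas, with the usual transformation law on overlaps; the component    *)
(* functions in the chart c are only meaningful on ccod c.                    *)
(* Recall that (jacobian tau p) i j = d_i tau^j (p).                          *)

Section Fields.
Context {R : realType} {n : nat} {M : manifold R n}.

Definition chart_family (X : Type) := chart R n M -> 'rV[R]_n -> X.

Definition vector_field (v : chart_family 'rV[R]_n) :=
  (forall c, atlas c -> forall i : 'I_n,
     smooth_on (ccod c) (fun p => v c p 0 i)) /\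
  (forall c c', atlas c -> atlas c' -> forall p, overlap c c' p ->
     v c' (transition c c' p) = v c p *m jacobian (transition c c') p).

Definition riemannian_metric (g : chart_family 'M[R]_n) :=
  [/\ forall c, atlas c -> forall i j : 'I_n,
        smooth_on (ccod c) (fun p => g c p i j),
      forall c, atlas c -> forall p, ccod c p ->
        (g c p)^T = g c p /\
        forall x : 'rV[R]_n, x != 0 -> 0 < (x *m g c p *m x^T) 0 0 &
      forall c c', atlas c -> atlas c' -> forall p, overlap c c' p ->
        g c p = jacobian (transition c c') p *m g c' (transition c c' p)
                *m (jacobian (transition c c') p)^T].

(* The space Omega^k(M) *)
Definition Omega (k : nat) : set (chart_family (exterior R n)) :=
  [set w : chart_family (exterior R n) |
    [/\ forall c, atlas c -> forall I : {set 'I_n},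
          smooth_on (ccod c) (fun p => w c p I),
        forall c, atlas c -> forall p, ccod c p -> homog k (w c p) &
        forall c c', atlas c -> atlas c' -> forall p, overlap c c' p ->
          w c p = ext_pullback (jacobian (transition c c') p)
                           (w c' (transition c c' p))]].

Implicit Types (w : chart_family (exterior R n)).

Definition ext_d w : chart_family (exterior R n) := fun c => ext_deriv (w c).

Variables (g : chart_family 'M[R]_n) (v : chart_family 'rV[R]_n).

Definition star w : chart_family (exterior R n) :=
  fun c p => hodge (g c p) (w c p).

Definition star_inv w : chart_family (exterior R n) :=
  fun c p => hodge_inv (g c p) (w c p).

Definition Tfield w : chart_family (exterior R n) :=
  fun c p => Tmap (g c p) (v c p) (w c p).

Definition Tfield_inv w : chart_family (exterior R n) :=
  fun c p => Tmap_inv (g c p) (v c p) (w c p).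

(* In the next three definitions k is the degree of w. *)
Definition codiff (k : nat) w : chart_family (exterior R n) :=
  fun c p => (-1) ^+ k *: star_inv (ext_d (star w)) c p.

Definition codiff_v (k : nat) w : chart_family (exterior R n) :=
  Tfield_inv (codiff k (Tfield w)).

Definition laplacian_v (k : nat) w : chart_family (exterior R n) :=
  fun c p => ext_d (codiff_v k w) c p + codiff_v k.+1 (ext_d w) c p.

End Fields.

Section Elliptic.
Context {R : realType} {n : nat}.
Variables (k m : nat).

(* Multi-indices are functions 'I_n -> {0, ..., m}, filtered by their length. *)
Notation multi_index := {ffun 'I_n -> 'I_m.+1}.

Definition mlength (A : multi_index) : nat := (\sum_(i < n) A i)%N.

Definition mpartial (A : multi_index) (f : 'rV[R]_n -> R) : 'rV[R]_n -> R :=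
  partials (flatten [seq nseq (A i) i | i <- enum 'I_n]) f.

Definition mpower (xi : 'rV[R]_n) (A : multi_index) : R :=
  \prod_(i < n) xi 0 i ^+ A i.

(* The coefficient a A I J multiplies the derivative of order A of the J-th   *)
(* component in the I-th component of the result.                             *)
Definition coefficients :=
  multi_index -> {set 'I_n} -> {set 'I_n} -> 'rV[R]_n -> R.

Definition local_operator (a : coefficients) (w : 'rV[R]_n -> exterior R n)
    (p : 'rV[R]_n) : exterior R n :=
  [ffun I : {set 'I_n} => if #|I| == k then
     \sum_(A : multi_index | (mlength A <= m)%N)
       \sum_(J : {set 'I_n} | #|J| == k)
          a A I J p * mpartial A (fun q => w q J) p
   else 0].

Definition principal_symbol (a : coefficients) (p xi : 'rV[R]_n)
    (b : exterior R n) : exterior R n :=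
  [ffun I : {set 'I_n} => if #|I| == k then
     \sum_(A : multi_index | mlength A == m)
       \sum_(J : {set 'I_n} | #|J| == k) a A I J p * mpower xi A * b J
   else 0].

(* P is a differential operator of order m from Omega^k(M) to Omega^k(M) with *)
(* smooth coefficients, and its principal symbol at each nonzero covector is  *)
(* an isomorphism of the space of k-covectors.                                *)
Definition elliptic (M : manifold R n)
    (P : chart_family (M := M) (exterior R n) ->
         chart_family (M := M) (exterior R n)) :=
  (forall w, Omega k w -> Omega k (P w)) /\
  (forall c : chart R n M, atlas c -> exists a : coefficients,
     [/\ forall A I J, smooth_on (ccod c) (a A I J),
         forall w, Omega k w -> forall p, ccod c p ->
           P w c p = local_operator a (w c) p &
         forall p, ccod c p -> forall xi : 'rV[R]_n, xi != 0 ->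
           set_bij (homog k) (homog k) (principal_symbol a p xi)]).

End Elliptic.

(* Main.v *)
From mathcomp Require Import all_boot all_order all_algebra.
From mathcomp Require Import all_classical all_reals all_analysis.
From mathcomp Require Import ring lra finset.
From HB Require Import structures.
Require Import Defs.
Import Order.TTheory GRing.Theory Num.Theory.
Import numFieldNormedType.Exports.

(** Ellipticity is a statement about the principal symbol, i.e. about linear
    algebra at one point. Replacing d by w /\ _ for a covector w <> 0, the
    symbol of the v-induced Laplacian on k-covectors is E = e s + s e with
    e = w /\ _ and s = (-1)^k T^-1 star^-1 e star T. From the definition of the
    Hodge star, a /\ star b = <a, b> mu, moving w across a in a /\ w /\ star b
    shows that star^-1 e star is, up to sign, the adjoint of e for <.,.>; hence
    s is minus the adjoint of e for the form <a, T b> ([codiff_symbol_adjoint]). This form is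
    symmetric and positive definite, since
    <a, T b> = <a, b> + <iota_v a, iota_v b> ([ext_inner_T]). Therefore
    <b, T E b> = - <s b, T s b> - <e b, T e b> ([laplacian_symbol_energy]), and
    E b = 0 forces e b = 0 and s b = 0. As w /\ _ is exact ([ext_mul_exact]),
    b = e c for some c, and s e c = 0 gives <e c, T e c> = 0, so b = 0. An
    injective endomorphism of a finite dimensional space is bijective
    ([laplacian_symbol_bij]).

    It remains to see that the Laplacian is a differential operator with smooth
    coefficients which maps forms to forms.

    The exterior algebra is generated by covectors, so identities in it follow
    by induction on the number of factors ([ext_ind]) from a few rules: left
    multiplications by covectors anticommute, contractions are antiderivations,
    and pullbacks are multiplicative. The last rule is the Laplace expansion of
    minors ([minor_expand], [ext_pullback_mul]); it contains the Cauchy-Binet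
    formula ([ext_pullbackM]). The Hodge star, its inverse and that of T, which are
    given implicitly, then get closed forms ([hodgeE], [hodge_invE],
    [Tmap_invE]) that are visibly smooth in the metric and in v, and natural
    under orientation preserving changes of coordinates.

    The exterior derivative is natural because second derivatives are symmetric
    ([smooth_on_partialC], [ext_deriv_pullback]). Finally, the Leibniz rule
    brings compositions of first order operators into a normal form
    ([second_order_comp]) from which the coefficients with respect to
    multi-indices, and the principal symbol, are read off
    ([second_order_operator]). *)

Set Implicit Arguments.
Unset Strict Implicit.
Unset Printing Implicit Defensive.

Local Open Scope ring_scope.

(** * Linear maps and the monomial basis *)

Section Alg.
Local Open Scope set_scope.
Context {R : realType} {n : nat}.
Implicit Types (I J K L : {set 'I_n}) (a b z : exterior R n) (v w u : 'rV[R]_n).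
Implicit Types (i j : 'I_n) (c : R).

Lemma ext_addE a b I : (a + b) I = a I + b I. Proof. by rewrite ffunE. Qed.
Lemma ext_oppE a I : (- a) I = - a I. Proof. by rewrite ffunE. Qed.
Lemma ext_scaleE c a I : (c *: a) I = c * a I. Proof. by rewrite ffunE. Qed.
Lemma ext_zeroE I : (0 : exterior R n) I = 0. Proof. by rewrite ffunE. Qed.

Definition ext_linear (F : exterior R n -> exterior R n) :=
  forall c a b, F (c *: a + b) = c *: F a + F b.

Section LinearMaps.
Variable F : exterior R n -> exterior R n.
Hypothesis linF : ext_linear F.

Lemma ext_linear0 : F 0 = 0.
Proof. by have := linF 1 0 0; rewrite !scale1r addr0 => /eqP; rewrite addrC -subr_eq subrr => /eqP <-. Qed.
Lemma ext_linearD a b : F (a + b) = F a + F b.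
Proof. by have := linF 1 a b; rewrite !scale1r. Qed.
Lemma ext_linearZ c a : F (c *: a) = c *: F a.
Proof. by have := linF c a 0; rewrite ext_linear0 !addr0. Qed.
Lemma ext_linearN a : F (- a) = - F a.
Proof. by rewrite -scaleN1r ext_linearZ scaleN1r. Qed.
Lemma ext_linearB a b : F (a - b) = F a - F b.
Proof. by rewrite ext_linearD ext_linearN. Qed.
Lemma ext_linear_sum (T : Type) (r : seq T) (Q : pred T) (f : T -> exterior R n) :
  F (\sum_(t <- r | Q t) f t) = \sum_(t <- r | Q t) F (f t).
Proof. exact: (big_morph _ ext_linearD ext_linear0). Qed.
End LinearMaps.

Lemma ext_linear_comp F F' : ext_linear F -> ext_linear F' -> ext_linear (F \o F').
Proof. by move=> lF lF' c a b; rewrite /= lF' lF. Qed.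

Lemma ext_linear_add F F' : ext_linear F -> ext_linear F' ->
  ext_linear (fun a => F a + F' a).
Proof.
move=> lF lF' c a b; rewrite lF lF'; apply/ffunP => I.
by rewrite !(ext_addE, ext_scaleE); ring.
Qed.

Lemma ext_linear_scale c F : ext_linear F -> ext_linear (fun a => c *: F a).
Proof. by move=> lF d a b; rewrite lF scalerDr !scalerA mulrC. Qed.

Definition dx I : exterior R n := [ffun J : {set 'I_n} => (J == I)%:R].

Lemma ext_basis a : a = \sum_I a I *: dx I.
Proof.
apply/ffunP => K; rewrite sum_ffunE (bigD1 K) //= big1 ?addr0.
  by rewrite ext_scaleE ffunE eqxx mulr1.
by move=> I nIK; rewrite ext_scaleE ffunE eq_sym (negbTE nIK) mulr0.
Qed.

Lemma ext_linear_ext F F' : ext_linear F -> ext_linear F' ->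
  (forall I, F (dx I) = F' (dx I)) -> forall a, F a = F' a.
Proof.
move=> lF lF' eqF a; rewrite (ext_basis a) !ext_linear_sum //.
by apply: eq_bigr => I _; rewrite !ext_linearZ // eqF.
Qed.

(** * Wedging with a covector and contraction *)

(** The sign for which dx^i /\ dx^I = sgn i I dx^(i |: I). *)
Definition sgn i I : R := (-1) ^+ inversions [set i]%SET I.

Lemma inversionsE I J : inversions I J = (\sum_(i in I) \sum_(j in J) (j < i)%N)%N.
Proof.
rewrite /inversions cardsE -sum1_card pair_big_dep /=.
rewrite big_mkcond [RHS]big_mkcond /=; apply: eq_bigr => -[i j] _ /=.
by rewrite !unfold_in /= andbA; case: ((i \in I) && _) => //=; case: ltnP.
Qed.

Lemma inversionsUl I I' J : [disjoint I & I'] ->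
  inversions (I :|: I') J = (inversions I J + inversions I' J)%N.
Proof. move=> dII; rewrite !inversionsE -bigU //=.
by apply: eq_bigl => i; rewrite !inE. Qed.

Lemma inversionsUr I J J' : [disjoint J & J'] ->
  inversions I (J :|: J') = (inversions I J + inversions I J')%N.
Proof.
move=> dJJ; rewrite !inversionsE -big_split /=; apply: eq_bigr => i _.
by rewrite -bigU //=; apply: eq_bigl => j; rewrite !inE.
Qed.

Lemma inversions11 i j : inversions [set i]%SET [set j]%SET = (j < i)%N.
Proof. by rewrite inversionsE !big_set1. Qed.

Lemma sgnU1 i j I : j \notin I -> sgn i (j |: I) = (-1) ^+ (j < i)%N * sgn i I.
Proof.
move=> jI; rewrite /sgn inversionsUr ?inversions11 ?exprD //.
by rewrite disjoints1.
Qed.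

Lemma sgnK i I : sgn i I * sgn i I = 1.
Proof. by rewrite /sgn -expr2 sqrr_sign. Qed.

Lemma sgn_neq i j : i != j -> (-1) ^+ (j < i)%N = - (-1) ^+ (i < j)%N :> R.
Proof.
move=> nij; case: ltngtP => [||e]; rewrite ?expr0 ?expr1 ?opprK //.
by rewrite (val_inj e) eqxx in nij.
Qed.

Definition ext_mul w a : exterior R n := ext_wedge (covector w) a.

Lemma ext_mulE w a K :
  ext_mul w a K = \sum_(i in K) sgn i (K :\ i) * w 0 i * a (K :\ i).
Proof.
rewrite ffunE [RHS]big_mkcond /=.
under eq_bigr => I IK.
  rewrite ffunE mulr_sumr mulr_suml big_mkcond /=. over.
rewrite exchange_big /=; apply: eq_bigr => i _.
rewrite -big_mkcondr /=; case: ifPn => iK.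
  rewrite (big_pred1 [set i]%SET) // => I /=.
  by apply/andP/eqP => [[_ /eqP]|->] //; rewrite sub1set eqxx.
rewrite big1 // => I /andP[IK /eqP eI].
by move: IK; rewrite eI sub1set (negbTE iK).
Qed.

Lemma contractionE v a I :
  contraction v a I = \sum_(i | i \notin I) sgn i I * v 0 i * a (i |: I).
Proof. by rewrite ffunE. Qed.

Lemma ext_wedge_linear_l b : ext_linear (ext_wedge^~ b).
Proof.
move=> c a a'; apply/ffunP => K; rewrite ext_addE ext_scaleE !ffunE mulr_sumr.
rewrite -big_split /=; apply: eq_bigr => I _.
by rewrite ext_addE ext_scaleE mulrDr mulrDl; congr (_ + _); ring.
Qed.

Lemma ext_wedge_linear_r b : ext_linear (ext_wedge b).
Proof.
move=> c a a'; apply/ffunP => K; rewrite ext_addE ext_scaleE !ffunE mulr_sumr.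
rewrite -big_split /=; apply: eq_bigr => I _.
by rewrite ext_addE ext_scaleE mulrDr; congr (_ + _); ring.
Qed.

Lemma ext_mul_linear w : ext_linear (ext_mul w).
Proof. exact: ext_wedge_linear_r. Qed.

Lemma contraction_linear v : ext_linear (contraction v).
Proof.
move=> c a b; apply/ffunP => I; rewrite ext_addE ext_scaleE !contractionE.
rewrite mulr_sumr -big_split /=; apply: eq_bigr => i _.
by rewrite ext_addE ext_scaleE; ring.
Qed.

Lemma covector_linear c w w' : covector (c *: w + w') = c *: covector w + covector w'.
Proof.
apply/ffunP => I; rewrite ext_addE ext_scaleE !ffunE mulr_sumr -big_split /=.
by apply: eq_bigr => i _; rewrite !mxE.
Qed.

Lemma ext_mul_linear_l c w w' a :
  ext_mul (c *: w + w') a = c *: ext_mul w a + ext_mul w' a.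
Proof. by rewrite /ext_mul covector_linear ext_wedge_linear_l. Qed.

Lemma ext_mul0l a : ext_mul 0 a = 0.
Proof.
by have := ext_mul_linear_l (-1) 0 0 a; rewrite scaler0 addr0 scaleN1r addNr.
Qed.

Lemma ext_mulDl w w' a : ext_mul (w + w') a = ext_mul w a + ext_mul w' a.
Proof. by rewrite -[w]scale1r ext_mul_linear_l !scale1r. Qed.

Lemma ext_mulZl c w a : ext_mul (c *: w) a = c *: ext_mul w a.
Proof. by rewrite -[c *: w]addr0 ext_mul_linear_l ext_mul0l addr0. Qed.

Lemma ext_mul_suml (T : Type) (r : seq T) (Q : pred T) (f : T -> 'rV[R]_n) a :
  ext_mul (\sum_(t <- r | Q t) f t) a = \sum_(t <- r | Q t) ext_mul (f t) a.
Proof. exact: (big_morph (ext_mul^~ a) (fun x y => ext_mulDl x y a) (ext_mul0l a)). Qed.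

Lemma rowE_sum w : w = \sum_i w 0 i *: ('e_i : 'rV[R]_n).
Proof. exact: row_sum_delta. Qed.

(** The terms for (i, j) and (j, i) cancel, since exactly one of i < j and
    j < i holds. *)
Lemma ext_mul_anti w w' a : ext_mul w (ext_mul w' a) = - ext_mul w' (ext_mul w a).
Proof.
have main x y K : ext_mul x (ext_mul y a) K =
    \sum_i \sum_(j | [&& i \in K, j \in K & i != j])
     (-1) ^+ (j < i)%N * (sgn i (K :\ i :\ j) * sgn j (K :\ i :\ j)) *
      x 0 i * y 0 j * a (K :\ i :\ j).
  rewrite ext_mulE big_mkcond; apply: eq_bigr => i _; case: ifPn => iK; last first.
    by rewrite big_pred0 // => j.
  rewrite ext_mulE mulr_sumr; apply: eq_big => j.
    by rewrite !inE eq_sym andbC.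
  rewrite !inE => /andP[ji jK].
  have -> : sgn i (K :\ i) = (-1) ^+ (j < i)%N * sgn i (K :\ i :\ j).
    by rewrite -sgnU1 ?setD1K ?inE ?eqxx ?ji.
  by ring.
apply/ffunP => K; rewrite ext_oppE !main (exchange_big_dep xpredT) //= -sumrN.
apply: eq_bigr => i _.
rewrite -sumrN; apply: eq_big => j; first by rewrite eq_sym andbCA.
move=> /and3P[jK iK nij]; rewrite (sgn_neq nij) setDDl setUC -setDDl; ring.
Qed.

Lemma ext_mul_mul w a : ext_mul w (ext_mul w a) = 0.
Proof.
apply/ffunP => K; rewrite ext_zeroE.
have /ffunP/(_ K) := ext_mul_anti w w a; rewrite ext_oppE; lra.
Qed.

Definition pairing v w : R := (v *m w^T) 0 0.

Lemma pairingE v w : pairing v w = \sum_i v 0 i * w 0 i.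
Proof. by rewrite /pairing mxE; apply: eq_bigr => i _; rewrite mxE. Qed.

(** Cartan's rule: the diagonal terms i = j give the pairing, and in the
    others the two orders of removing j and adding i differ by a sign. *)
Lemma contraction_mul v w a :
  contraction v (ext_mul w a) = pairing v w *: a - ext_mul w (contraction v a).
Proof.
apply/ffunP => K; rewrite ext_addE ext_oppE ext_scaleE.
rewrite contractionE ext_mulE pairingE.
have -> : \sum_(i | i \notin K) sgn i K * v 0 i * ext_mul w a (i |: K) =
  \sum_(i | i \notin K) (v 0 i * w 0 i * a K +
     \sum_(j in K) sgn i K * sgn j (i |: (K :\ j)) * v 0 i * w 0 j * a (i |: (K :\ j))).
  apply: eq_bigr => i iK; rewrite ext_mulE big_setU1 //= mulrDr; congr (_ + _).
    by rewrite setU1K // -[LHS]mul1r -(sgnK i K); have := sgnK i K; set s := sgn i K => e; ring: e.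
  rewrite mulr_sumr; apply: eq_bigr => j jK.
  have -> : ((i |: K) :\ j = i |: (K :\ j))%SET.
    apply/setP => x; rewrite !inE; case: (eqVneq x i) => [->|] //=.
    by rewrite andbT; apply/eqP => e; rewrite e jK in iK.
  ring.
have -> : \sum_(j in K) sgn j (K :\ j) * w 0 j * contraction v a (K :\ j) =
  \sum_(j in K) (v 0 j * w 0 j * a K +
     \sum_(i | i \notin K) sgn j (K :\ j) * sgn i (K :\ j) * v 0 i * w 0 j * a (i |: (K :\ j))).
  apply: eq_bigr => j jK; rewrite contractionE (bigD1 j) /= ?inE ?eqxx //.
  rewrite mulrDr setD1K //; congr (_ + _).
    by have := sgnK j (K :\ j)%SET; set s := sgn j _ => e; ring: e.
  rewrite mulr_sumr; apply: eq_big => i.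
    rewrite !inE negb_and negbK; case: (eqVneq i j) => [->|] //=; last by rewrite andbT.
    by rewrite jK.
  by move=> _; ring.
rewrite big_split /= [in X in _ - X]big_split /= [in RHS](bigID (mem K)) /= mulrDl.
rewrite !mulr_suml.
set X := \sum_(i | i \notin K) \sum_(j in K) _; set Y := \sum_(i | _) \sum_(j | _) _.
suff -> : Y = - X by ring.
rewrite /X /Y exchange_big /= -sumrN; apply: eq_bigr => i iK; rewrite -sumrN.
apply: eq_bigr => j jK; have nij : i != j.
  by apply: contraNneq iK => ->.
have -> : sgn i K = (-1) ^+ (j < i)%N * sgn i (K :\ j).
  by rewrite -sgnU1 ?setD1K // !inE eqxx.
rewrite sgnU1; last by rewrite !inE (negbTE iK) andbF.
rewrite (sgn_neq nij).
have := @sqrr_sign R (i < j)%N; set s := (-1) ^+ _ => e; ring: e.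
Qed.

Definition dot a b : R := \sum_(I : {set 'I_n}) a I * b I.

Lemma dotC a b : dot a b = dot b a.
Proof. by apply: eq_bigr => I _; rewrite mulrC. Qed.

Lemma dot_linear_l c a a' b : dot (c *: a + a') b = c * dot a b + dot a' b.
Proof.
rewrite /dot mulr_sumr -big_split; apply: eq_bigr => I _.
by rewrite ext_addE ext_scaleE mulrDl mulrA.
Qed.

Lemma dot_linear_r c a b b' : dot a (c *: b + b') = c * dot a b + dot a b'.
Proof. by rewrite dotC dot_linear_l !(dotC a). Qed.

Lemma dot_ge0 a : 0 <= dot a a.
Proof. by apply: sumr_ge0 => I _; rewrite -expr2 sqr_ge0. Qed.

Lemma dot_eq0 a : dot a a = 0 -> a = 0.
Proof.
move=> /eqP; rewrite psumr_eq0 => [/allP a0|I _]; last by rewrite -expr2 sqr_ge0.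
apply/ffunP => I; rewrite ext_zeroE; apply/eqP.
by have := a0 I (mem_index_enum I); rewrite /= mulf_eq0 orbb.
Qed.

Lemma dot_ext a b : (forall z, dot z a = dot z b) -> a = b.
Proof.
move=> ab; apply/eqP; rewrite -subr_eq0; apply/eqP/dot_eq0.
have := dot_linear_r (-1) (a - b) b a; rewrite scaleN1r mulN1r addrC => ->.
by rewrite ab addNr.
Qed.

Lemma dot_dxl I b : dot (dx I) b = b I.
Proof.
rewrite /dot (bigD1 I) //= big1 ?addr0; first by rewrite ffunE eqxx mul1r.
by move=> J JI; rewrite ffunE (negbTE JI) mul0r.
Qed.

Lemma sum_set_in_notin i (F : {set 'I_n} -> R) :
  \sum_(K : {set 'I_n} | i \in K) F K = \sum_(I : {set 'I_n} | i \notin I) F (i |: I).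
Proof.
rewrite (reindex_onto (fun I => i |: I)%SET (fun K => K :\ i)%SET) /=; last first.
  by move=> K iK; rewrite setD1K.
apply: eq_bigl => I; rewrite setU11 /=; apply/eqP/idP => [<-|iI].
  by rewrite !inE eqxx.
by rewrite setU1K.
Qed.

(** Wedging with a covector and contracting with the same coordinates are
    transposes of one another in the standard basis. *)
Lemma dot_mul_contraction u a b : dot (ext_mul u a) b = dot a (contraction u b).
Proof.
have -> : dot (ext_mul u a) b =
    \sum_i \sum_(K : {set 'I_n} | i \in K) sgn i (K :\ i) * u 0 i * a (K :\ i) * b K.
  rewrite (exchange_big_dep xpredT) //=; apply: eq_bigr => K _.
  by rewrite ext_mulE mulr_suml.
have -> : dot a (contraction u b) =
    \sum_i \sum_(I : {set 'I_n} | i \notin I) sgn i I * u 0 i * a I * b (i |: I).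
  rewrite (exchange_big_dep xpredT) //=; apply: eq_bigr => I _.
  by rewrite contractionE mulr_sumr; apply: eq_bigr => i _; ring.
apply: eq_bigr => i _; rewrite sum_set_in_notin; apply: eq_bigr => I iI.
by rewrite setU1K.
Qed.

(** Associativity of the wedge product when the first factor is a covector,
    which is enough because covectors generate. *)
Lemma ext_mul_wedge w a b : ext_wedge (ext_mul w a) b = ext_mul w (ext_wedge a b).
Proof.
apply/ffunP => K; rewrite ext_mulE ffunE.
under eq_bigr => L LK do rewrite ext_mulE mulr_sumr mulr_suml.
rewrite (exchange_big_dep (mem K)) /=; last first.
  by move=> L i /fintype.subsetP LK /LK.
apply: eq_bigr => i iK; rewrite ffunE mulr_sumr.
rewrite (reindex_onto (fun I => i |: I)%SET (fun L => L :\ i)%SET) /=; last first.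
  by move=> L /andP[_ iL]; rewrite setD1K.
apply: eq_big => I.
  rewrite setU11 andbT subUset sub1set iK /= subsetD1; congr (_ && _).
  apply/eqP/idP => [<-|iI]; first by rewrite !inE eqxx.
  by rewrite setU1K.
rewrite setU11 andbT => /andP[IK /eqP eI].
have iI : i \notin I by rewrite -eI !inE eqxx.
rewrite setU1K // -setDDl.
rewrite inversionsUl ?exprD; last by rewrite disjoints1.
have -> : sgn i (K :\ i) = sgn i I * sgn i (K :\ i :\: I).
  rewrite /sgn -exprD -inversionsUr; last first.
    by rewrite disjoint_sym disjoints_subset setDE subsetIr.
  congr (_ ^+ inversions _ _); apply/setP => x; rewrite !inE.
  have [xI|//] := boolP (x \in I); rewrite /= (fintype.subsetP IK) ?inE ?xI ?orbT ?andbT //.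
  by apply: contraNneq iI => <-.
rewrite -/(sgn i _); ring.
Qed.

(** * Generation by covectors *)

Definition one : exterior R n := dx set0.

Lemma ext_wedge1 b : ext_wedge one b = b.
Proof.
apply/ffunP => K; rewrite ffunE (bigD1 set0) ?sub0set //= big1 ?addr0.
  rewrite ffunE eqxx mulr1 setD0.
  rewrite /inversions cardsE eq_card0 ?mul1r // => -[i j].
  by rewrite unfold_in /= inE.
by move=> I /andP[_ I0]; rewrite ffunE (negbTE I0) mulr0 mul0r.
Qed.

Lemma ext_mul_basisE i a K :
  ext_mul 'e_i a K = (i \in K)%:R * (sgn i (K :\ i) * a (K :\ i)).
Proof.
rewrite ext_mulE; have [iK|iK] := boolP (i \in K).
  rewrite (bigD1 i) //= big1 ?addr0 ?mul1r; first by rewrite mxE !eqxx mulr1.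
  by move=> k /andP[_ ki]; rewrite mxE eqxx (negbTE ki) mulr0 mul0r.
rewrite mul0r big1 // => k kK; rewrite mxE eqxx /=.
have -> : (k == i) = false by apply: contraNF iK => /eqP <-.
by rewrite mulr0 mul0r.
Qed.

Lemma ext_mul_dx i I : i \notin I -> ext_mul 'e_i (dx I) = sgn i I *: dx (i |: I).
Proof.
move=> iI; apply/ffunP => K; rewrite ext_mul_basisE ext_scaleE !ffunE.
have [->|nK] := eqVneq K (i |: I)%SET.
  by rewrite setU11 setU1K // eqxx mul1r.
have [iK|] := boolP (i \in K); last by rewrite mul0r mulr0.
have -> : (K :\ i == I)%SET = false; last by rewrite !mulr0.
by apply: contraNF nK => /eqP <-; rewrite setD1K.
Qed.

Lemma dx_setU1 i I : i \notin I -> dx (i |: I) = sgn i I *: ext_mul 'e_i (dx I).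
Proof. by move=> iI; rewrite ext_mul_dx // scalerA sgnK scale1r. Qed.

(** Every monomial is up to sign a product of covectors, whence an induction
    principle through which the identities below are checked. *)
Lemma ext_ind (Q : exterior R n -> Prop) :
  (forall c a b, Q a -> Q b -> Q (c *: a + b)) -> Q one ->
  (forall w a, Q a -> Q (ext_mul w a)) -> forall a, Q a.
Proof.
move=> Qlin Q1 Qmul.
have Q0 : Q 0 by have := Qlin (-1) one one Q1 Q1; rewrite scaleN1r addNr.
have Qdx I : Q (dx I).
  elim: {I}#|I| {-2}I (erefl #|I|) => [I /cards0_eq -> //|k IH I cI].
  have [i iI] : exists i, i \in I by apply/card_gt0P; rewrite cI.
  rewrite -(setD1K iI) dx_setU1 ?inE ?eqxx // -[X in Q X]addr0.
  apply: Qlin => //; apply: Qmul; apply: IH.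
  by move: cI; rewrite (cardsD1 i) iI add1n => -[].
move=> a; rewrite (ext_basis a); elim/big_rec : _ => // I b _ Qb.
exact: Qlin.
Qed.

(** The grading involution *)
Definition ext_sign a : exterior R n := [ffun I : {set 'I_n} => (-1) ^+ #|I| * a I].

Lemma ext_sign_linear : ext_linear ext_sign.
Proof.
move=> c a b; apply/ffunP => I; rewrite ext_addE ext_scaleE ![ext_sign _ _]ffunE.
by rewrite ext_addE ext_scaleE; ring.
Qed.

Lemma ext_sign_mul w a : ext_sign (ext_mul w a) = - ext_mul w (ext_sign a).
Proof.
apply/ffunP => K; rewrite ext_oppE ffunE !ext_mulE mulr_sumr -sumrN.
apply: eq_bigr => i iK; rewrite ffunE (cardsD1 i) iK exprS; ring.
Qed.

(** A covector passes from the right factor to the left one at the cost of the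
    grading involution. *)
Lemma ext_wedge_mulr w a z :
  ext_wedge a (ext_mul w z) = ext_wedge (ext_mul w (ext_sign a)) z.
Proof.
elim/ext_ind: a z => [c a b IHa IHb|| u a IH] z.
- by rewrite ext_wedge_linear_l IHa IHb ext_sign_linear ext_mul_linear ext_wedge_linear_l.
- have -> : ext_sign one = one.
    apply/ffunP => I; rewrite !ffunE; have [->|_] := eqVneq I set0.
      by rewrite cards0 mulr1.
    by rewrite mulr0.
  by rewrite ext_wedge1 ext_mul_wedge ext_wedge1.
- rewrite ext_mul_wedge IH ext_sign_mul (ext_linearN (ext_mul_linear _)).
  by rewrite -ext_mul_wedge ext_mul_anti.
Qed.

Lemma ext_sign_homog k a : homog k a -> ext_sign a = (-1) ^+ k *: a.
Proof.
move=> ka; apply/ffunP => I; rewrite ext_scaleE ffunE.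
by have [->//|nk] := eqVneq #|I| k; rewrite ka // !mulr0.
Qed.

(** * Minors and pullbacks *)

Lemma index_sorted_count i (s : seq 'I_n) : sorted (relpre val ltn) s -> i \in s ->
  index i s = count (fun j : 'I_n => j < i)%N s.
Proof.
elim: s => //= x s IH px; rewrite inE.
have lx : all (fun j : 'I_n => x < j)%N s.
  by apply: order_path_min px => // a b c; apply: ltn_trans.
case: (eqVneq i x) => [->|nix] /=.
  move=> _; rewrite ltnn (@eq_in_count _ _ pred0) ?count_pred0 // => j js.
  by apply/negbTE; rewrite -leqNgt ltnW // (allP lx).
move=> is_; rewrite (allP lx) // add1n IH //.
exact: path_sorted px.
Qed.

Lemma enum_sorted K : sorted (relpre val ltn) (enum K).
Proof.
rewrite /enum_mem; apply: sorted_filter => [a b c|]; first exact: ltn_trans.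
rewrite -enumT -sorted_map val_enum_ord.
exact: iota_ltn_sorted.
Qed.

Lemma inversions_index i K : i \in K -> inversions [set i] (K :\ i) = index i (enum K).
Proof.
move=> iK; rewrite inversionsE big_set1.
have -> : (\sum_(j in K :\ i) (j < i)%N = \sum_(j in K) (j < i)%N)%N.
  by rewrite [RHS](bigD1 i) //= ltnn; apply: eq_bigl => j; rewrite !inE andbC.
rewrite index_sorted_count ?mem_enum ?enum_sorted // -big_enum /=.
by rewrite -sum1_count [RHS]big_mkcond.
Qed.

(** Deleting the element at position a renumbers the others as [lift] does with
    the rows of a cofactor. *)
Lemma nth_enum_setD1 i0 K (a x : nat) : (a < #|K|)%N ->
  nth i0 (enum (K :\ nth i0 (enum K) a)) x = nth i0 (enum K) (bump a x).
Proof.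
move=> aK; set i := nth i0 (enum K) a.
have -> : enum (K :\ i) = rem i (enum K).
  rewrite (rem_filter _ (enum_uniq _)) /enum_mem -filter_predI.
  by apply: eq_filter => y; rewrite /= !inE.
rewrite remE index_uniq ?enum_uniq -?cardE // nth_cat size_take -cardE aK.
rewrite /bump; case: ltnP => [xa|ax]; first by rewrite nth_take.
by rewrite nth_drop addSn subnKC // add1n.
Qed.

Lemma minor_nth (A : 'M[R]_n) i0 m I J : #|I| = m -> #|J| = m ->
  minor A I J = \det (\matrix_(a < m, b < m)
    A (nth i0 (enum I) a) (nth i0 (enum J) b)).
Proof.
move=> cI cJ; rewrite /minor; case: eqP => [e|]; last by rewrite cI cJ.
case: m / cI cJ => cJ; congr (\det _); apply/matrixP => a b.
by rewrite !mxE /= !(enum_val_nth i0).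
Qed.

Lemma minor_neq0 (A : 'M[R]_n) I J : #|I| != #|J| -> minor A I J = 0.
Proof. by rewrite /minor; case: eqP. Qed.

Lemma big_set_nth i0 m K (F : 'I_n -> R) : #|K| = m ->
  \sum_(i in K) F i = \sum_(a < m) F (nth i0 (enum K) a).
Proof.
move=> cK; rewrite -big_enum (big_nth i0) /= -(big_mkord xpredT (F \o nth i0 (enum K))) /=.
by rewrite -cK cardE.
Qed.

(** Laplace expansion of a minor along its column j. The usual sign is
    (-1)^(a + b) for the positions a of i in K and b of j in J; the position of
    i in K counts the elements of K below i, as does the exponent in sgn i. *)
Lemma minor_expand (A : 'M[R]_n) K J j : j \in J ->
  minor A K J = \sum_(i in K)
     sgn i (K :\ i) * A i j * (sgn j (J :\ j) * minor A (K :\ i) (J :\ j)).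
Proof.
move=> jJ; have cJ := cardsD1 j J; rewrite jJ add1n in cJ.
have [cK|nKJ] := eqVneq #|K| #|J|; last first.
  rewrite minor_neq0 // big1 // => i iK; rewrite minor_neq0 ?mulr0 //.
  by apply: contraNneq nKJ => e; rewrite (cardsD1 i) iK cJ e.
rewrite cJ in cK; set m := #|J :\ j| in cJ cK.
rewrite (minor_nth A j cK cJ).
have bJ : (index j (enum J) < m.+1)%N by rewrite -cJ cardE index_mem mem_enum.
rewrite (expand_det_col _ (Ordinal bJ)) (big_set_nth j _ cK).
apply: eq_bigr => a _; set i := nth j (enum K) a.
have iK : i \in K by rewrite -mem_enum mem_nth // -cardE cK.
have cKi : #|K :\ i| = m by apply: succn_inj; rewrite -cK (cardsD1 i K) iK.
rewrite mxE /= nth_index ?mem_enum // /cofactor /= (minor_nth A j cKi (erefl m)).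
rewrite /sgn !inversions_index // index_uniq ?enum_uniq -?cardE ?cK // exprD.
rewrite [in RHS](_ : \matrix_(_, _) _ =
   row' a (col' (Ordinal bJ) (\matrix_(a < m.+1, b < m.+1)
      A (nth j (enum K) a) (nth j (enum J) b)))); first by ring.
apply/matrixP => x y; rewrite !mxE /= -nth_enum_setD1 ?cK //; congr (A _ _).
by rewrite -nth_enum_setD1 ?cJ // nth_index ?mem_enum.
Qed.

Lemma minor00 (A : 'M[R]_n) I : minor A I set0 = (I == set0)%:R.
Proof.
have [->|I0] := eqVneq I set0; last by rewrite minor_neq0 // cards0 cards_eq0.
rewrite /minor; case: eqP => // e; move: (cast_ord e) => f.
move: (f) (@enum_val _ _); rewrite cards0 => f' g.
by rewrite det_mx00.
Qed.

Lemma ext_pullback_linear (A : 'M[R]_n) : ext_linear (ext_pullback A).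
Proof.
move=> c a b; apply/ffunP => I; rewrite ext_addE ext_scaleE ![ext_pullback _ _ _]ffunE.
rewrite mulr_sumr -big_split; apply: eq_bigr => J _ /=.
by rewrite ext_addE ext_scaleE; ring.
Qed.

Lemma ext_pullback_dx (A : 'M[R]_n) I J : ext_pullback A (dx J) I = minor A I J.
Proof.
rewrite ffunE (bigD1 J) //= big1 ?addr0 => [|K KJ]; rewrite ffunE ?eqxx ?mulr1 //.
by rewrite (negbTE KJ) mulr0.
Qed.

Lemma ext_pullback1 (A : 'M[R]_n) : ext_pullback A one = one.
Proof. by apply/ffunP => I; rewrite ext_pullback_dx minor00 ffunE. Qed.

(** For w = e_j and a = dx^J with j not in J this is the Laplace expansion. If
    j is in J both sides vanish, because covectors have square zero. *)
Lemma ext_pullback_mul (A : 'M[R]_n) w a :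
  ext_pullback A (ext_mul w a) = ext_mul (w *m A^T) (ext_pullback A a).
Proof.
have main j J : j \notin J ->
    ext_pullback A (ext_mul 'e_j (dx J)) = ext_mul ('e_j *m A^T) (ext_pullback A (dx J)).
  move=> jJ; rewrite ext_mul_dx // (ext_linearZ (ext_pullback_linear A)).
  apply/ffunP => K; rewrite ext_scaleE ext_pullback_dx (@minor_expand _ _ _ j) ?setU11 //.
  rewrite setU1K // mulr_sumr ext_mulE; apply: eq_bigr => i iK.
  rewrite ext_pullback_dx -rowE !mxE.
  by have := sgnK j J; set s := sgn j J => e; ring: e.
have basis j J :
    ext_pullback A (ext_mul 'e_j (dx J)) = ext_mul ('e_j *m A^T) (ext_pullback A (dx J)).
  have [jJ|/main//] := boolP (j \in J); rewrite -(setD1K jJ) dx_setU1 ?inE ?eqxx //.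
  rewrite (ext_linearZ (ext_mul_linear _)) ext_mul_mul scaler0.
  rewrite !(ext_linearZ (ext_pullback_linear A)) main ?inE ?eqxx //.
  by rewrite (ext_linearZ (ext_mul_linear _)) ext_mul_mul scaler0 (ext_linear0 (ext_pullback_linear A)).
rewrite (rowE_sum w) mulmx_suml !ext_mul_suml (ext_linear_sum (ext_pullback_linear A)).
apply: eq_bigr => j _; rewrite -scalemxAl !ext_mulZl (ext_linearZ (ext_pullback_linear A)).
congr (_ *: _); move: a; apply: ext_linear_ext => [c a b|c a b|J]; last exact: basis.
  by rewrite ext_mul_linear ext_pullback_linear.
by rewrite ext_pullback_linear ext_mul_linear.
Qed.

Lemma ext_pullback_wedge (A : 'M[R]_n) a b :
  ext_pullback A (ext_wedge a b) = ext_wedge (ext_pullback A a) (ext_pullback A b).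
Proof.
elim/ext_ind: a => [c a a' IH IH'||w a IH].
- by rewrite ext_wedge_linear_l !ext_pullback_linear ext_wedge_linear_l IH IH'.
- by rewrite ext_pullback1 !ext_wedge1.
- by rewrite ext_mul_wedge !ext_pullback_mul ext_mul_wedge IH.
Qed.

(** Functoriality of the pullback, i.e. the Cauchy-Binet formula *)
Lemma ext_pullbackM (A B : 'M[R]_n) a :
  ext_pullback A (ext_pullback B a) = ext_pullback (A *m B) a.
Proof.
elim/ext_ind: a => [c a a' IH IH'||w a IH].
- by rewrite !ext_pullback_linear IH IH'.
- by rewrite !ext_pullback1.
- by rewrite !ext_pullback_mul IH trmx_mul mulmxA.
Qed.

Lemma ext_pullback_id a : ext_pullback 1%:M a = a.
Proof.
elim/ext_ind: a => [c a a' IH IH'||w a IH].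
- by rewrite !ext_pullback_linear IH IH'.
- by rewrite !ext_pullback1.
- by rewrite ext_pullback_mul IH trmx1 mulmx1.
Qed.

Lemma contraction1 v : contraction v one = 0.
Proof.
apply/ffunP => I; rewrite contractionE ext_zeroE big1 // => i _.
rewrite ffunE; have -> : (i |: I == set0) = false; last by rewrite mulr0.
by apply/negbTE/set0Pn; exists i; rewrite setU11.
Qed.

Lemma ext_pullback_contraction (A : 'M[R]_n) v a :
  contraction v (ext_pullback A a) = ext_pullback A (contraction (v *m A) a).
Proof.
elim/ext_ind: a => [c a a' IH IH'||w a IH].
- by rewrite ext_pullback_linear !contraction_linear ext_pullback_linear IH IH'.
- by rewrite ext_pullback1 !contraction1 (ext_linear0 (ext_pullback_linear A)).
- rewrite ext_pullback_mul !contraction_mul IH (ext_linearB (ext_pullback_linear A)).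
  rewrite (ext_linearZ (ext_pullback_linear A)) ext_pullback_mul.
  by rewrite /pairing trmx_mul trmxK mulmxA.
Qed.

Lemma dot_pullback (A : 'M[R]_n) a b :
  dot (ext_pullback A a) b = dot a (ext_pullback A^T b).
Proof.
elim/ext_ind: a b => [c a a' IH IH'||w a IH] b.
- by rewrite ext_pullback_linear !dot_linear_l IH IH'.
- rewrite ext_pullback1 !dot_dxl ffunE (bigD1 set0) //= minor00 eqxx mul1r big1 ?addr0 //.
  by move=> J J0; rewrite minor_neq0 ?mul0r // cards0 eq_sym cards_eq0.
- by rewrite ext_pullback_mul !dot_mul_contraction IH ext_pullback_contraction.
Qed.

Definition top a : R := a setT.

Lemma det_mxsub_val m (A : 'M[R]_n) (f g : 'I_m -> 'I_n) : m = n ->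
  (forall x, f x = x :> nat) -> (forall x, g x = x :> nat) ->
  \det (mxsub f g A) = \det A.
Proof.
move=> e; move: f g; rewrite e => f g fE gE; congr (\det _).
have idE (h : 'I_n -> 'I_n) : (forall x : 'I_n, h x = x :> nat) -> h =1 id by move=> hE x; apply: ord_inj; exact: hE.
by apply/matrixP => i j; rewrite mxE (idE _ fE) (idE _ gE).
Qed.

Lemma top_pullback (A : 'M[R]_n) a : top (ext_pullback A a) = \det A * top a.
Proof.
rewrite /top ffunE (bigD1 setT) //= big1 ?addr0 => [|J JT]; last first.
  rewrite minor_neq0 ?mul0r // cardsT card_ord eq_sym; apply: contraNneq JT => cJ.
  by rewrite eqEcard subsetT cardsT card_ord cJ leqnn.
congr (_ * _); rewrite /minor; case: eqP => // e.
have val (i : 'I_#|[set: 'I_n]|) : enum_val i = i :> nat.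
  have i0 := enum_val i; have := ltn_ord i; rewrite {2}cardsT card_ord => lti.
  rewrite (enum_val_nth i0) enum_setT -enumT nth_enum_ord //.
by apply: det_mxsub_val => [|x|x]; rewrite ?cardsT ?card_ord //= val.
Qed.

(** * Inner products and the Hodge star *)

Definition spd (m : nat) (G : 'M[R]_m) :=
  G^T = G /\ forall x : 'rV[R]_m, x != 0 -> 0 < (x *m G *m x^T) 0 0.

(** Cholesky factorisation, by induction through the Schur complement *)
Lemma spd_cholesky m (G : 'M[R]_m) : spd G ->
  exists2 B : 'M[R]_m, B \in unitmx & G = B *m B^T.
Proof.
elim: m G => [|m IH] G [symG posG].
  by exists 1%:M; [exact: unitmx1|apply/matrixP => -[]].
rewrite -[m.+1]/(1 + m)%N in G symG posG *.
set a := ulsubmx G 0 0; set b := ursubmx G; set C := drsubmx G.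
have ulE : ulsubmx G = a%:M by rewrite [LHS]mx11_scalar.
have dlE : dlsubmx G = b^T.
  by rewrite -[in LHS]symG -{1}(submxK G) tr_block_mx block_mxKdl.
have CE : C^T = C by rewrite /C -[in RHS]symG trmx_drsub.
have GE : G = block_mx a%:M b b^T C by rewrite -ulE -dlE submxK.
have a_gt0 : 0 < a.
  have := posG (row_mx 1%:M 0); rewrite GE mul_row_block tr_row_mx mul_row_col.
  rewrite !mul1mx !mul0mx !addr0 trmx1 trmx0 mulmx1 mulmx0 addr0.
  rewrite mxE mulr1n; apply.
  apply/eqP => /(congr1 lsubmx); rewrite row_mxKl linear0 => /matrixP/(_ 0 0).
  by rewrite !mxE eqxx => /eqP; rewrite oner_eq0.
have a0 : a != 0 by rewrite gt_eqF.
pose S := C - a^-1 *: (b^T *m b).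
have [|B uB SE] := IH S.
  split; first by rewrite /S linearB linearZ /= trmx_mul trmxK CE.
  (* G takes at this vector the value of its Schur complement at y. *)
  move=> y y0; have := posG (row_mx (- (a^-1 *: (y *m b^T))) y).
  rewrite GE mul_row_block tr_row_mx mul_row_col.
  have -> : - (a^-1 *: (y *m b^T)) *m a%:M + y *m b^T = 0.
    by rewrite mul_mx_scalar scalerN scalerA mulfV // scale1r addNr.
  rewrite mul0mx add0r.
  have -> : - (a^-1 *: (y *m b^T)) *m b + y *m C = y *m S.
    by rewrite /S mulmxBr mulNmx -scalemxAl -scalemxAr mulmxA addrC.
  apply; apply: contraNneq y0 => /(congr1 rsubmx).
  by rewrite row_mxKr linear0 => ->.
have sa0 : 0 < Num.sqrt a by rewrite sqrtr_gt0.
have sa2 : Num.sqrt a * Num.sqrt a = a by rewrite -expr2 sqr_sqrtr // ltW.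
exists (block_mx (Num.sqrt a)%:M 0 ((Num.sqrt a)^-1 *: b^T) B).
  rewrite unitmxE det_lblock det_scalar1 unitrM -unitmxE uB andbT.
  by rewrite unitfE gt_eqF.
rewrite tr_block_mx mulmx_block !trmx0 !mulmx0 !mul0mx !addr0 -SE.
rewrite tr_scalar_mx -scalar_mxM sa2 linearZ /= trmxK mul_scalar_mx scalerA.
rewrite mulfV ?gt_eqF // scale1r mul_mx_scalar scalerA mulfV ?gt_eqF // scale1r.
by rewrite -scalemxAl -scalemxAr scalerA -invfM sa2 /S addrC subrK.
Qed.

Lemma spd_det m (G : 'M[R]_m) : spd G -> 0 < \det G.
Proof.
move=> /spd_cholesky[B uB ->]; rewrite det_mulmx det_tr -expr2 exprn_even_gt0 //=.
by rewrite -unitfE -unitmxE.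
Qed.

Lemma spd_unit m (G : 'M[R]_m) : spd G -> G \in unitmx.
Proof. by move=> /spd_det; rewrite unitmxE unitfE => /gt_eqF ->. Qed.

Implicit Types (G A : 'M[R]_n).

Lemma ext_innerE G a b : ext_inner G a b = dot a (ext_pullback (invmx G) b).
Proof.
apply: eq_bigr => I _; rewrite ffunE mulr_sumr; apply: eq_bigr => J _; ring.
Qed.

Lemma ext_inner_linear_r G c a b b' :
  ext_inner G a (c *: b + b') = c * ext_inner G a b + ext_inner G a b'.
Proof. by rewrite !ext_innerE ext_pullback_linear dot_linear_r. Qed.

Lemma ext_innerDr G a b b' : ext_inner G a (b + b') = ext_inner G a b + ext_inner G a b'.
Proof. by rewrite -[b]scale1r ext_inner_linear_r mul1r scale1r. Qed.

Lemma ext_inner0r G a : ext_inner G a 0 = 0.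
Proof. by rewrite -[0](addNr (0 : exterior R n)) -scaleN1r ext_inner_linear_r mulN1r addNr. Qed.

Lemma ext_innerZr G c a b : ext_inner G a (c *: b) = c * ext_inner G a b.
Proof. by rewrite -[c *: b]addr0 ext_inner_linear_r ext_inner0r addr0. Qed.

Lemma ext_innerC G a b : G^T = G -> ext_inner G a b = ext_inner G b a.
Proof.
by move=> symG; rewrite !ext_innerE dotC dot_pullback trmx_inv symG.
Qed.

Lemma ext_inner_mul G u a b :
  ext_inner G (ext_mul u a) b = ext_inner G a (contraction (u *m invmx G) b).
Proof. by rewrite !ext_innerE dot_mul_contraction ext_pullback_contraction. Qed.

Lemma invmxM (A B : 'M[R]_n) : A \in unitmx -> B \in unitmx ->
  invmx (A *m B) = invmx B *m invmx A.
Proof.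
move=> uA uB; have uAB : A *m B \in unitmx by rewrite unitmx_mul uA.
by rewrite -[RHS](mulKmx uAB) -mulmxA (mulmxA B) mulmxV // mul1mx mulmxV // mulmx1.
Qed.

(** With G = B B^T the inner product of G is the standard one after pulling
    back along B^-1. *)
Lemma ext_inner_gram G a : spd G ->
  exists2 z, ext_inner G a a = dot z z & (z = 0 -> a = 0).
Proof.
move=> /spd_cholesky[B uB GE]; exists (ext_pullback (invmx B) a).
  rewrite ext_innerE GE; have -> : invmx (B *m B^T) = (invmx B)^T *m invmx B.
    by rewrite trmx_inv invmxM ?unitmx_tr.
  by rewrite -ext_pullbackM dotC dot_pullback trmxK.
move=> z0; rewrite -[a]ext_pullback_id -(mulmxV uB) -ext_pullbackM z0.
exact: ext_linear0 (ext_pullback_linear B).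
Qed.

Lemma ext_inner_ge0 G a : spd G -> 0 <= ext_inner G a a.
Proof. by move=> /(ext_inner_gram a)[z -> _]; apply: dot_ge0. Qed.

Lemma ext_inner_eq0 G a : spd G -> ext_inner G a a = 0 -> a = 0.
Proof. by move=> /(ext_inner_gram a)[z -> z0] /dot_eq0. Qed.

(** The Hodge star of the standard metric, a signed permutation of monomials *)
Definition std_star b : exterior R n :=
  [ffun K : {set 'I_n} => (-1) ^+ inversions (~: K) K * b (~: K)].

Definition std_star_inv z : exterior R n :=
  [ffun I : {set 'I_n} => (-1) ^+ inversions I (~: I) * z (~: I)].

Lemma std_starK : cancel std_star std_star_inv.
Proof.
move=> b; apply/ffunP => I; rewrite !ffunE setCK mulrA -expr2 sqrr_sign.
exact: mul1r.
Qed.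

Lemma std_star_invK : cancel std_star_inv std_star.
Proof.
move=> b; apply/ffunP => I; rewrite !ffunE setCK mulrA -expr2 sqrr_sign.
exact: mul1r.
Qed.

Lemma std_star_linear : ext_linear std_star.
Proof.
move=> c a b; apply/ffunP => I; rewrite ext_addE ext_scaleE ![std_star _ _]ffunE.
by rewrite ext_addE ext_scaleE; ring.
Qed.

Lemma std_star_inv_linear : ext_linear std_star_inv.
Proof.
move=> c a b; apply/ffunP => I; rewrite ext_addE ext_scaleE ![std_star_inv _ _]ffunE.
by rewrite ext_addE ext_scaleE; ring.
Qed.

Lemma top_wedge a z : top (ext_wedge a z) = dot a (std_star_inv z).
Proof.
rewrite /top ffunE; apply: eq_big => [I|I _]; first exact: subsetT.
by rewrite ffunE setTD; ring.
Qed.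

(** Closed form of the Hodge star, from which linearity and smooth dependence on
    the metric are apparent *)
Definition ext_star G b := Num.sqrt (\det G) *: std_star (ext_pullback (invmx G) b).

Definition ext_star_inv G z := (Num.sqrt (\det G))^-1 *: ext_pullback G (std_star_inv z).

Lemma ext_star_linear G : ext_linear (ext_star G).
Proof.
move=> c a b; rewrite /ext_star ext_pullback_linear std_star_linear.
by rewrite scalerDr !scalerA mulrC.
Qed.

Lemma ext_star_inv_linear G : ext_linear (ext_star_inv G).
Proof.
move=> c a b; rewrite /ext_star_inv std_star_inv_linear ext_pullback_linear.
by rewrite scalerDr !scalerA mulrC.
Qed.

Lemma top_wedge_star G a b :
  top (ext_wedge a (ext_star G b)) = Num.sqrt (\det G) * ext_inner G a b.
Proof.
rewrite top_wedge /ext_star (ext_linearZ std_star_inv_linear) std_starK ext_innerE.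
by rewrite -[_ *: _]addr0 dot_linear_r [dot a 0]big1 ?addr0 // => I _; rewrite ext_zeroE mulr0.
Qed.

(** The wedge product pairs complementary degrees perfectly. *)
Lemma top_wedge_inj z z' :
  (forall a, top (ext_wedge a z) = top (ext_wedge a z')) -> z = z'.
Proof.
move=> zz'; rewrite -[z]std_star_invK -[z']std_star_invK; congr std_star.
by apply: dot_ext => a; rewrite -!top_wedge.
Qed.

Lemma ext_starK G : spd G -> cancel (ext_star G) (ext_star_inv G).
Proof.
move=> Gspd b; rewrite /ext_star_inv /ext_star (ext_linearZ std_star_inv_linear).
rewrite std_starK (ext_linearZ (ext_pullback_linear _)) scalerA mulVf ?scale1r.
  by rewrite ext_pullbackM mulmxV ?spd_unit // ext_pullback_id.
by rewrite gt_eqF // sqrtr_gt0 spd_det.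
Qed.

Lemma ext_star_invK G : spd G -> cancel (ext_star_inv G) (ext_star G).
Proof.
move=> Gspd b; rewrite /ext_star_inv /ext_star (ext_linearZ (ext_pullback_linear _)).
rewrite ext_pullbackM mulVmx ?spd_unit // ext_pullback_id.
rewrite (ext_linearZ std_star_linear) std_star_invK scalerA mulfV ?scale1r //.
by rewrite gt_eqF // sqrtr_gt0 spd_det.
Qed.

Lemma top_wedge_part k a z : (k <= n)%N -> homog k a ->
  top (ext_wedge a (ext_part (n - k) z)) = top (ext_wedge a z).
Proof.
move=> kn ka; rewrite !top_wedge; apply: eq_bigr => I _; rewrite !ffunE.
have [cI|nI] := eqVneq #|I| k; last by rewrite ka // !mul0r.
by rewrite cardsCs setCK card_ord cI eqxx.
Qed.

Lemma ext_inner_part G k a b : homog k a ->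
  ext_inner G a (ext_part k b) = ext_inner G a b.
Proof.
move=> ka; apply: eq_bigr => I _; apply: eq_bigr => J _; rewrite ffunE.
have [cI|nI] := eqVneq #|I| k; last by rewrite ka // !mul0r.
case: eqP => // /eqP nJ; rewrite minor_neq0 ?mulr0 // cI eq_sym //.
Qed.

(** The degrees of the factors add up to n, so only the top component
    survives. *)
Lemma wedge_part_vol k a z : (k <= n)%N -> homog k a ->
  ext_wedge a (ext_part (n - k) z) =
  [ffun K : {set 'I_n} => top (ext_wedge a z) *+ (K == setT)].
Proof.
move=> kn ka; apply/ffunP => K; rewrite [RHS]ffunE.
have [->|KT] := eqVneq K setT; first by rewrite mulr1n -(top_wedge_part z kn ka).
rewrite mulr0n ffunE big1 // => I IK; rewrite ffunE.
have [cI|nI] := eqVneq #|I| k; last by rewrite ka // mulr0 mul0r.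
case: eqP => [cK|]; last by rewrite mulr0.
case/negP: KT; rewrite eqEcard subsetT cardsT card_ord.
have := cardsID I K; rewrite (setIidPr IK) cK cI => <-.
by rewrite /= subnKC.
Qed.

(** The defining condition of the Hodge star amounts to its top components,
    which say that a /\ star b has top component <a, b> sqrt (det G) for all a;
    this determines star b. *)
Lemma hodgeE G b : hodge G b = ext_star G b.
Proof.
apply: xget_unique => [k a ka|z Qz].
  rewrite wedge_part_vol ?top_wedge_star ?leq_ord // ext_inner_part //.
  apply/ffunP => K; rewrite ext_scaleE !ffunE.
  by case: eqP => _; rewrite ?mulr1n ?mulr0n ?mulr0 // mulrC.
rewrite -[z]std_star_invK /ext_star -(ext_linearZ std_star_linear); congr std_star.
apply/ffunP => I; rewrite -dot_dxl -top_wedge.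
have cI : (#|I| < n.+1)%N by rewrite ltnS -[X in (_ <= X)%N]card_ord max_card.
have hI : homog #|I| (dx I).
  by move=> J cJ; rewrite ffunE; have [eJ|//] := eqVneq J I; rewrite eJ eqxx in cJ.
have /ffunP/(_ setT) := Qz (Ordinal cI) (dx I) hI.
rewrite wedge_part_vol // ext_inner_part // ext_scaleE !ffunE eqxx !mulr1n => ->.
by rewrite ext_innerE dot_dxl ffunE mulrC.
Qed.

Lemma hodge_invE G z : spd G -> hodge_inv G z = ext_star_inv G z.
Proof.
move=> Gspd; apply: (can_inj (ext_starK Gspd)); rewrite ext_star_invK // -hodgeE.
have surj : set_surj [set: exterior R n]%classic [set: exterior R n]%classic (hodge G).
  by move=> y _; exists (ext_star_inv G y); rewrite // hodgeE ext_star_invK.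
by rewrite /hodge_inv (surjpK _ surj) // classical_sets.in_setT.
Qed.

(** * The endomorphism T and its inverse *)

(** T = 1 + e with e = v^flat /\ iota_v satisfies e^2 = |v|^2 e, hence
    T^-1 = 1 - e / (1 + |v|^2). *)
Definition ext_T_inv G v a : exterior R n :=
  a - (1 + pairing v (v *m G))^-1 *: ext_mul (v *m G) (contraction v a).

Lemma TmapE G v a : Tmap G v a = a + ext_mul (v *m G) (contraction v a).
Proof. by []. Qed.

Lemma Tmap_linear G v : ext_linear (Tmap G v).
Proof.
move=> c a b; rewrite !TmapE contraction_linear ext_mul_linear scalerDr.
by rewrite addrACA.
Qed.

Lemma ext_T_inv_linear G v : ext_linear (ext_T_inv G v).
Proof.
move=> c a b; rewrite /ext_T_inv contraction_linear ext_mul_linear !scalerDr !scalerN.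
by rewrite !scalerA mulrC opprD addrACA.
Qed.

Lemma pairing_spd_ge0 G v : spd G -> 0 <= pairing v (v *m G).
Proof.
move=> [symG posG]; rewrite /pairing trmx_mul symG mulmxA.
have [->|/posG/ltW//] := eqVneq v 0; by rewrite !mul0mx mxE.
Qed.

(** By Cartan's rule, as u /\ u = 0 *)
Lemma mul_contraction_sqr u v a :
  ext_mul u (contraction v (ext_mul u (contraction v a))) =
  pairing v u *: ext_mul u (contraction v a).
Proof.
rewrite contraction_mul (ext_linearB (ext_mul_linear u)) ext_mul_mul subr0.
by rewrite (ext_linearZ (ext_mul_linear u)).
Qed.

Lemma TmapK G v : spd G -> cancel (Tmap G v) (ext_T_inv G v).
Proof.
move=> Gspd a; have v2 := pairing_spd_ge0 v Gspd.
rewrite /ext_T_inv TmapE (ext_linearD (contraction_linear v)).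
rewrite (ext_linearD (ext_mul_linear _)) mul_contraction_sqr.
set e := ext_mul _ _; rewrite -{2}[e]scale1r -scalerDl scalerA mulVf ?scale1r ?addrK //.
by rewrite gt_eqF // ltr_pwDl.
Qed.

Lemma ext_T_invK G v : spd G -> cancel (ext_T_inv G v) (Tmap G v).
Proof.
move=> Gspd a; have v2 := pairing_spd_ge0 v Gspd; have lt := contraction_linear v.
rewrite TmapE /ext_T_inv (ext_linearB lt) (ext_linearZ lt).
rewrite (ext_linearB (ext_mul_linear _)) (ext_linearZ (ext_mul_linear _)).
rewrite mul_contraction_sqr.
set e := ext_mul _ _; set p := pairing _ _; rewrite scalerA -[X in _ + (X - _)]scale1r -scalerBl.
rewrite -addrA -scaleNr -scalerDl.
have p1 : 1 + p != 0 by rewrite gt_eqF // ltr_pwDl.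
rewrite [X in X *: e](_ : _ = 0) ?scale0r ?addr0 //; by field.
Qed.

Lemma Tmap_invE G v z : spd G -> Tmap_inv G v z = ext_T_inv G v z.
Proof.
move=> Gspd; apply: (can_inj (TmapK v Gspd)); rewrite ext_T_invK //.
have surj : set_surj [set: exterior R n]%classic [set: exterior R n]%classic (Tmap G v).
  by move=> y _; exists (ext_T_inv G v y); rewrite // ext_T_invK.
by rewrite /Tmap_inv (surjpK _ surj) // classical_sets.in_setT.
Qed.

Lemma ext_inner_flat G v a b : spd G ->
  ext_inner G (ext_mul (v *m G) a) b = ext_inner G a (contraction v b).
Proof. by move=> Gspd; rewrite ext_inner_mul mulmxK // spd_unit. Qed.

(** v^flat /\ _ and iota_v are adjoint, so T is symmetric and positive
    definite. *)
Lemma ext_inner_T G v a b : spd G ->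
  ext_inner G a (Tmap G v b) =
  ext_inner G a b + ext_inner G (contraction v a) (contraction v b).
Proof.
move=> Gspd; have [symG _] := Gspd; rewrite TmapE ext_innerDr; congr (_ + _).
by rewrite ext_innerC // ext_inner_flat // ext_innerC.
Qed.

Lemma ext_inner_TC G v a b : spd G ->
  ext_inner G a (Tmap G v b) = ext_inner G b (Tmap G v a).
Proof.
move=> Gspd; have [symG _] := Gspd; rewrite !ext_inner_T // (ext_innerC a) //.
by rewrite (ext_innerC (contraction v a)).
Qed.

Lemma ext_inner_T_ge0 G v a : spd G -> 0 <= ext_inner G a (Tmap G v a).
Proof. by move=> Gspd; rewrite ext_inner_T // addr_ge0 ?ext_inner_ge0. Qed.

Lemma ext_inner_T_eq0 G v a : spd G -> ext_inner G a (Tmap G v a) = 0 -> a = 0.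
Proof.
move=> Gspd; rewrite ext_inner_T // => /eqP.
by rewrite paddr_eq0 ?ext_inner_ge0 // => /andP[/eqP/(ext_inner_eq0 Gspd)].
Qed.

(** * Naturality under orientation preserving linear maps *)

Section Naturality.
Variables (G G' A : 'M[R]_n) (v v' : 'rV[R]_n).
Hypotheses (Gspd : spd G) (Gspd' : spd G') (detA : 0 < \det A).
Hypotheses (GE : G = A *m G' *m A^T) (vE : v' = v *m A).

Let uA : A \in unitmx. Proof. by rewrite unitmxE unitfE gt_eqF. Qed.

Lemma ext_pullbackVK : cancel (ext_pullback (invmx A)) (ext_pullback A).
Proof. by move=> a; rewrite ext_pullbackM mulmxV // ext_pullback_id. Qed.

Lemma ext_inner_pullback a b :
  ext_inner G (ext_pullback A a) (ext_pullback A b) = ext_inner G' a b.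
Proof.
rewrite !ext_innerE dot_pullback !ext_pullbackM; congr (dot _ (ext_pullback _ _)).
have uG' := spd_unit Gspd'; have uT : A^T \in unitmx by rewrite unitmx_tr.
rewrite GE !invmxM ?unitmx_mul ?uG' ?uA //.
by rewrite mulKVmx // -mulmxA mulVmx // mulmx1.
Qed.

(** Both sides have the same wedge product with every pulled back form; the
    volume forms correspond because det A > 0. *)
Lemma ext_star_pullback b :
  ext_star G (ext_pullback A b) = ext_pullback A (ext_star G' b).
Proof.
apply: top_wedge_inj => a; rewrite -[a]ext_pullbackVK; set a' := ext_pullback _ a.
rewrite top_wedge_star ext_inner_pullback -ext_pullback_wedge top_pullback top_wedge_star.
rewrite mulrA; congr (_ * _); rewrite GE !det_mulmx det_tr mulrC mulrA -expr2.
by rewrite sqrtrM ?sqr_ge0 // sqrtr_sqr ger0_norm // ltW.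
Qed.

Lemma ext_star_inv_pullback z :
  ext_star_inv G (ext_pullback A z) = ext_pullback A (ext_star_inv G' z).
Proof.
apply: (can_inj (ext_starK Gspd)).
by rewrite ext_star_invK // ext_star_pullback ext_star_invK.
Qed.

Lemma Tmap_pullback a :
  Tmap G v (ext_pullback A a) = ext_pullback A (Tmap G' v' a).
Proof.
rewrite !TmapE (ext_linearD (ext_pullback_linear A)) ext_pullback_mul.
by rewrite ext_pullback_contraction vE GE !mulmxA.
Qed.

Lemma ext_T_inv_pullback a :
  ext_T_inv G v (ext_pullback A a) = ext_pullback A (ext_T_inv G' v' a).
Proof.
apply: (can_inj (TmapK v Gspd)).
by rewrite ext_T_invK // Tmap_pullback ext_T_invK.
Qed.

End Naturality.

(** * Degrees *)

Lemma homog_mul k w a : homog k a -> homog k.+1 (ext_mul w a).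
Proof.
move=> ka K cK; rewrite ext_mulE big1 // => i iK; rewrite ka ?mulr0 //.
by apply: contraNneq cK => <-; rewrite [X in X == _](cardsD1 i) iK.
Qed.

Lemma homog_contraction k v a : homog k.+1 a -> homog k (contraction v a).
Proof.
move=> ka I cI; rewrite contractionE big1 // => i iI; rewrite ka ?mulr0 //.
by apply: contraNneq cI => /eqP; rewrite cardsU1 iI add1n eqSS => /eqP ->.
Qed.

Lemma homog_mul_contraction k u v a : homog k a ->
  homog k (ext_mul u (contraction v a)).
Proof.
case: k => [|k] ka; last by apply/homog_mul/homog_contraction.
move=> K cK; rewrite ext_mulE big1 // => i iK; rewrite contractionE big1 ?mulr0 //.
by move=> j _; rewrite ka ?mulr0 // -lt0n card_gt0; apply/set0Pn; exists j; rewrite setU11.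
Qed.

Lemma homogD k a b : homog k a -> homog k b -> homog k (a + b).
Proof. by move=> ka kb I cI; rewrite ext_addE ka ?kb ?addr0. Qed.

Lemma homogZ k c a : homog k a -> homog k (c *: a).
Proof. by move=> ka I cI; rewrite ext_scaleE ka ?mulr0. Qed.

Lemma homogN k a : homog k a -> homog k (- a).
Proof. by move=> ka I cI; rewrite ext_oppE ka ?oppr0. Qed.

Lemma homog0 k : homog k (0 : exterior R n).
Proof. by move=> I _; rewrite ext_zeroE. Qed.

Lemma homog_T k G v a : homog k a -> homog k (Tmap G v a).
Proof. by move=> ka; apply: homogD => //; apply: homog_mul_contraction. Qed.

Lemma homog_T_inv k G v a : homog k a -> homog k (ext_T_inv G v a).
Proof.
move=> ka; apply: homogD => //; apply/homogN/homogZ.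
exact: homog_mul_contraction.
Qed.

Lemma homog_pullback k A a : homog k a -> homog k (ext_pullback A a).
Proof.
move=> ka I cI; rewrite ffunE big1 // => J _.
have [cIJ|nIJ] := eqVneq #|I| #|J|; last by rewrite minor_neq0 ?mul0r.
by rewrite ka ?mulr0 // -cIJ.
Qed.

(** Degree n - k, with no truncation when k > n *)
Definition cohomog k a := forall I, (#|I| + k)%N != n -> a I = 0.

Lemma cohomog_star k G a : homog k a -> cohomog k (ext_star G a).
Proof.
move=> ka I cI; rewrite ext_scaleE ffunE (homog_pullback _ ka) ?mulr0 //.
by apply: contraNneq cI => <-; rewrite cardsC card_ord.
Qed.

Lemma cohomog_mul k w a : cohomog k a ->
  forall I, (#|I| + k)%N != n.+1 -> ext_mul w a I = 0.
Proof.
move=> ka K cK; rewrite ext_mulE big1 // => i iK; rewrite ka ?mulr0 //.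
by apply: contraNneq cK => e; rewrite (cardsD1 i K) iK -addnA e.
Qed.

(** Degree k - 1, with no truncation when k = 0: a form that is prehomogeneous
    of order 0 vanishes, as does the codifferential of a function. *)
Definition prehomog k a := forall I, #|I|.+1 != k -> a I = 0.

Lemma prehomog0 a : prehomog 0 a -> a = 0.
Proof. by move=> a0; apply/ffunP => I; rewrite ext_zeroE a0. Qed.

Lemma prehomog_homog k a : prehomog k a -> homog k.-1 a.
Proof.
case: k => [/prehomog0 ->|k ka]; first exact: homog0.
by move=> I cI; apply: ka; rewrite eqSS.
Qed.

Lemma homog_prehomog k a : homog k a -> prehomog k.+1 a.
Proof. by move=> ka I; rewrite eqSS => /ka. Qed.

Lemma homog_mul_prehomog k w a : prehomog k a -> homog k (ext_mul w a).
Proof.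
case: k => [/prehomog0 ->|k /prehomog_homog]; last exact: homog_mul.
by rewrite (ext_linear0 (ext_mul_linear w)); apply: homog0.
Qed.

Lemma prehomog_contraction k v a : homog k a -> prehomog k (contraction v a).
Proof.
case: k => [|k] ka; last by apply/homog_prehomog/homog_contraction.
move=> I _; rewrite contractionE big1 // => j _.
by rewrite ka ?mulr0 // -lt0n card_gt0; apply/set0Pn; exists j; rewrite setU11.
Qed.

Lemma prehomog_T_inv k G v a : prehomog k a -> prehomog k (ext_T_inv G v a).
Proof.
case: k => [/prehomog0 ->|k /prehomog_homog/= ka].
  by rewrite (ext_linear0 (ext_T_inv_linear G v)) => I; rewrite ext_zeroE.
exact/homog_prehomog/homog_T_inv.
Qed.

Lemma prehomogZ k c a : prehomog k a -> prehomog k (c *: a).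
Proof. by move=> ka I cI; rewrite ext_scaleE ka ?mulr0. Qed.

Lemma prehomog_star_inv k G a : (forall I, (#|I| + k)%N != n.+1 -> a I = 0) ->
  prehomog k (ext_star_inv G a).
Proof.
case: k => [|k] ka.
  suff -> : a = 0 by rewrite (ext_linear0 (ext_star_inv_linear G)) => I; rewrite ext_zeroE.
  apply/ffunP => I; rewrite ext_zeroE ka // addn0 neq_ltn ltnS.
  by rewrite -[X in (_ <= X)%N]card_ord max_card.
apply: prehomogZ; apply: homog_prehomog; apply: homog_pullback => I cI.
rewrite ffunE ka ?mulr0 //; apply: contraNneq cI => /eqP; rewrite addnS eqSS => /eqP e.
by apply/eqP/(@addnI #|~: I|); rewrite e addnC cardsC card_ord.
Qed.

Lemma homog_part k a : homog k (ext_part k a).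
Proof. by move=> I /negbTE cI; rewrite ffunE cI. Qed.

Lemma ext_part_homog k a : homog k a -> ext_part k a = a.
Proof. by move=> ka; apply/ffunP => I; rewrite ffunE; case: eqP => // /eqP /ka. Qed.

Lemma ext_part_linear k : ext_linear (ext_part k).
Proof.
move=> c a b; apply/ffunP => I; rewrite ext_addE ext_scaleE ![ext_part _ _ _]ffunE.
by rewrite ext_addE ext_scaleE; case: ifP; rewrite // mulr0 addr0.
Qed.

(** To apply rank considerations to the space of k-covectors, the map is
    extended by the identity in the other degrees. *)
Lemma homog_inj_bij k F : ext_linear F -> (forall a, homog k a -> homog k (F a)) ->
  (forall a, homog k a -> F a = 0 -> a = 0) -> set_bij (homog k) (homog k) F.
Proof.
move=> lF Fk F0; split; first exact: Fk.
  move=> a b /set_mem ka /set_mem kb e; apply/eqP; rewrite -subr_eq0; apply/eqP/F0.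
    exact/homogD/homogN.
  by rewrite (ext_linearB lF) e subrr.
pose V := {ffun {set 'I_n} -> R^o}.
pose h (a : V) : V := F (ext_part k a) + (a - ext_part k a).
have lh : linear h.
  move=> c a b; rewrite /h (ext_part_linear k c a b) lF.
  rewrite scalerDr scalerBr opprD; apply/ffunP => I.
  rewrite !(ext_addE, ext_oppE, ext_scaleE); ring.
have h_part a : ext_part k (h a) = F (ext_part k a).
  rewrite /h (ext_linearD (ext_part_linear k)) (ext_linearB (ext_part_linear k)).
  by rewrite !(ext_part_homog (homog_part _)) ?subrr ?addr0 //; apply/ext_part_homog/Fk/homog_part.
pose hL : {linear V -> V} := HB.pack h (GRing.isLinear.Build _ _ _ _ h lh).
have kh : lker (linfun hL) == 0%VS.
  apply/lker0P => a b; rewrite !lfunE /= => hab.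
  apply/eqP; rewrite -subr_eq0; apply/eqP; set d : exterior R n := a - b.
  have hd : h d = 0.
    have -> : d = -1 *: b + a by rewrite scaleN1r addrC.
    by rewrite lh hab scaleN1r addNr.
  have pd : ext_part k d = 0.
    by apply: F0; [exact: homog_part|rewrite -h_part hd (ext_linear0 (ext_part_linear k))].
  by move: hd; rewrite /h pd (ext_linear0 lF) subr0 add0r.
(* The preimage under the extended map may have components in other degrees,
   which the map leaves unchanged. *)
move=> b kb; pose a := ((linfun hL)^-1)%VF b.
have ha : h a = b.
  by have := lker0_lfunVK kh b; rewrite lfunE.
exists (ext_part k a); first exact: homog_part.
by rewrite -h_part ha ext_part_homog.
Qed.

(** * The principal symbol of the Laplacian *)

Definition codiff_symbol G v w k b :=
  (-1) ^+ k *: ext_T_inv G v (ext_star_inv G (ext_mul w (ext_star G (Tmap G v b)))).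

Lemma codiff_symbol_linear G v w k : ext_linear (codiff_symbol G v w k).
Proof.
move=> c a b; rewrite /codiff_symbol Tmap_linear ext_star_linear ext_mul_linear.
by rewrite ext_star_inv_linear ext_T_inv_linear scalerDr !scalerA mulrC.
Qed.

Lemma prehomog_codiff_symbol G v w k b : homog k b ->
  prehomog k (codiff_symbol G v w k b).
Proof.
move=> kb; apply/prehomogZ/prehomog_T_inv/prehomog_star_inv/cohomog_mul.
exact/cohomog_star/homog_T.
Qed.

(** Both sides come from the top component of a /\ w /\ star T b, once as it
    stands and once with w moved in front of a. *)
Lemma codiff_symbol_adjoint G v w k a b : spd G -> prehomog k a ->
  ext_inner G a (Tmap G v (codiff_symbol G v w k b)) =
  - ext_inner G (ext_mul w a) (Tmap G v b).
Proof.
move=> Gspd; have [symG _] := Gspd.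
case: k => [/prehomog0 ->|k /prehomog_homog/= ka].
  rewrite (ext_linear0 (ext_mul_linear w)) !(ext_innerC 0) // !ext_inner0r oppr0 //.
rewrite /codiff_symbol (ext_linearZ (Tmap_linear G v)) ext_T_invK //.
set c := Tmap G v b; rewrite ext_innerZr.
have s0 : Num.sqrt (\det G) != 0 by rewrite gt_eqF // sqrtr_gt0 spd_det.
have -> : ext_inner G a (ext_star_inv G (ext_mul w (ext_star G c))) =
    (-1) ^+ k * ext_inner G (ext_mul w a) c.
  apply: (mulfI s0); rewrite -top_wedge_star ext_star_invK // ext_wedge_mulr.
  rewrite (ext_sign_homog ka) top_wedge_star (ext_linearZ (ext_mul_linear w)).
  by rewrite (ext_innerC (_ *: _)) // ext_innerZr ext_innerC.
by rewrite mulrA -exprD addSn exprS addnn -signr_odd odd_double mulr1 mulN1r.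
Qed.

Definition laplacian_symbol G v w k b :=
  ext_mul w (codiff_symbol G v w k b) + codiff_symbol G v w k.+1 (ext_mul w b).

(** Each of the two terms of the symbol composes a map with minus its adjoint. *)
Lemma laplacian_symbol_energy G v w k b : spd G -> homog k b ->
  ext_inner G b (Tmap G v (laplacian_symbol G v w k b)) =
  - (ext_inner G (codiff_symbol G v w k b) (Tmap G v (codiff_symbol G v w k b)) +
     ext_inner G (ext_mul w b) (Tmap G v (ext_mul w b))).
Proof.
move=> Gspd kb; rewrite (ext_linearD (Tmap_linear G v)) ext_innerDr.
rewrite (codiff_symbol_adjoint _ _ _ Gspd (homog_prehomog kb)).
rewrite ext_inner_TC // -[ext_inner _ (ext_mul w _) _]opprK.
rewrite -(codiff_symbol_adjoint v w b Gspd (prehomog_codiff_symbol _ _ _ kb)).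
by rewrite opprD.
Qed.

(** The Koszul complex of w is exact: contraction with a vector dual to w is a
    contracting homotopy, by Cartan's rule. *)
Lemma ext_mul_exact w b : w != 0 -> ext_mul w b = 0 ->
  exists2 u, pairing u w = 1 & b = ext_mul w (contraction u b).
Proof.
move=> w0 wb; have ww : pairing w w != 0.
  rewrite pairingE; apply: contra_neq w0 => /eqP.
  rewrite psumr_eq0 => [/allP h|i _]; last by rewrite -expr2 sqr_ge0.
  apply/rowP => i; rewrite mxE; apply/eqP.
  by have := h i (mem_index_enum i); rewrite /= mulf_eq0 orbb.
exists ((pairing w w)^-1 *: w).
  by rewrite /pairing -scalemxAl mxE mulVf.
have := contraction_mul ((pairing w w)^-1 *: w) w b.
rewrite wb (ext_linear0 (contraction_linear _)) => /esym/eqP.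
rewrite {1}/pairing -scalemxAl mxE mulVf // scale1r subr_eq0 => /eqP.
by [].
Qed.

(** By the energy identity a null covector b is killed by w /\ _, hence is of
    the form w /\ c, and by its adjoint; so the square of w /\ c is zero. *)
Lemma laplacian_symbol_inj G v w k b : spd G -> w != 0 -> homog k b ->
  laplacian_symbol G v w k b = 0 -> b = 0.
Proof.
move=> Gspd w0 kb s0; have := laplacian_symbol_energy v w Gspd kb.
rewrite s0 (ext_linear0 (Tmap_linear G v)) ext_inner0r => /esym/eqP.
rewrite oppr_eq0 paddr_eq0 ?ext_inner_T_ge0 // => /andP[/eqP Xb0 /eqP wb0].
have Xb := ext_inner_T_eq0 Gspd Xb0; have wb := ext_inner_T_eq0 Gspd wb0.
have [u _ bE] := ext_mul_exact w0 wb; rewrite bE.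
have := codiff_symbol_adjoint v w b Gspd (prehomog_contraction u kb).
rewrite Xb (ext_linear0 (Tmap_linear G v)) ext_inner0r -bE => /esym/eqP.
by rewrite oppr_eq0 => /eqP/(ext_inner_T_eq0 Gspd).
Qed.

Lemma laplacian_symbol_bij G v w k : spd G -> w != 0 ->
  set_bij (homog k) (homog k) (laplacian_symbol G v w k).
Proof.
move=> Gspd w0; apply: homog_inj_bij => [c a b|a ka|a]; last exact: laplacian_symbol_inj.
  apply: (@ext_linear_add (ext_mul w \o codiff_symbol G v w k)
                          (codiff_symbol G v w k.+1 \o ext_mul w)).
    exact: ext_linear_comp (ext_mul_linear w) (codiff_symbol_linear _ _ _ _).
  exact: ext_linear_comp (codiff_symbol_linear _ _ _ _) (ext_mul_linear w).
apply: homogD; first exact/homog_mul_prehomog/prehomog_codiff_symbol.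
exact/(prehomog_homog (k := k.+1))/prehomog_codiff_symbol/homog_mul.
Qed.

End Alg.

Local Open Scope classical_set_scope.
Local Open Scope ring_scope.

(** * Calculus of smooth functions *)

Section SmoothCalculus.
Context {R : realType} {n : nat}.
Implicit Types (f g h : 'rV[R]_n -> R) (U : set 'rV[R]_n) (p : 'rV[R]_n) (i j : 'I_n).

Lemma near_eq0_differentiable f p : (\near p, f p = 0) -> differentiable f p.
Proof.
move=> f0; have fp0 : f p = 0 by apply: (nbhs_singleton f0).
have E : f \o shift p = cst (f p) + (0 : 'rV[R]_n -> R) +o_ (0 : 'rV[R]_n) id.
  apply/eqaddoP => e e0; rewrite fp0.
  have : \forall x \near (0 : 'rV[R]_n), f (x + p) = 0.
    by move: f0; rewrite (near_shift 0) subr0.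
  apply: filterS => x fx; rewrite !fctE /= fx !addr0 subrr normr0.
  by rewrite mulr_ge0 // ltW.
apply/diff_locallyP; rewrite (diff_unique _ E); last exact: cst_continuous.
by split => //; exact: cst_continuous.
Qed.

Lemma near_eq_differentiable f g p : (\near p, f p = g p) ->
  differentiable f p -> differentiable g p.
Proof.
move=> fg df; have -> : g = f + (g - f) by rewrite addrC subrK.
apply: differentiableD => //; apply: near_eq0_differentiable.
by apply: filterS fg => x fgx; rewrite !fctE fgx subrr.
Qed.

Lemma near_in U p (P : 'rV[R]_n -> Prop) : open U -> U p ->
  (forall q, U q -> P q) -> \near p, P p.
Proof. by move=> oU Up UP; apply: filterS UP _; apply: open_nbhs_nbhs. Qed.

Lemma partial_eq_on U f g i : open U -> (forall p, U p -> f p = g p) ->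
  forall p, U p -> partial i f p = partial i g p.
Proof. by move=> oU fg p Up; apply: near_eq_derive; apply: near_in fg. Qed.

Lemma partials_eq_on U f g s : open U -> (forall p, U p -> f p = g p) ->
  forall p, U p -> partials s f p = partials s g p.
Proof.
by move=> oU fg; elim: s => //= i s IH; apply: partial_eq_on.
Qed.

Lemma smooth_on_eq U f g : open U -> (forall p, U p -> f p = g p) ->
  smooth_on U f -> smooth_on U g.
Proof.
move=> oU fg sf s p Up; apply: near_eq_differentiable (sf s p Up).
by apply: near_in (partials_eq_on s oU fg).
Qed.

Lemma smooth_on_differentiable U f p : smooth_on U f -> U p -> differentiable f p.
Proof. by move=> sf; apply: (sf [::]). Qed.

Lemma smooth_on_partial U f i : smooth_on U f -> smooth_on U (partial i f).
Proof. by move=> sf s p Up; have := sf (rcons s i) p Up; rewrite /partials foldr_rcons. Qed.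

(** Smoothness by coinduction: a family of differentiable functions that is
    stable under partial derivatives consists of smooth functions. *)
Lemma smooth_on_coind U (S : ('rV[R]_n -> R) -> Prop) : open U ->
  (forall f, S f -> forall p, U p -> differentiable f p) ->
  (forall f i, S f -> exists2 g, S g & forall p, U p -> partial i f p = g p) ->
  forall f, S f -> smooth_on U f.
Proof.
move=> oU dS pS f Sf s; elim/last_ind: s f Sf => [|s i IH] f Sf p Up.
  exact: dS.
have [g Sg fg] := pS f i Sf; rewrite /partials foldr_rcons -/(partials _ _).
apply: near_eq_differentiable (IH g Sg p Up).
by apply: near_in (partials_eq_on s oU _) => // q Uq; rewrite fg.
Qed.

Lemma partialE f i p : differentiable f p -> partial i f p = 'd f p 'e_i.
Proof. exact: deriveE. Qed.

Lemma partial_cst c i p : partial i (fun=> c : R) p = 0.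
Proof. exact: derive_cst. Qed.

Lemma partialD f g i p : differentiable f p -> differentiable g p ->
  partial i (fun q => f q + g q) p = partial i f p + partial i g p.
Proof. by move=> df dg; apply: deriveD; apply: diff_derivable. Qed.

Lemma partialM f g i p : differentiable f p -> differentiable g p ->
  partial i (fun q => f q * g q) p = partial i f p * g p + f p * partial i g p.
Proof.
move=> df dg; rewrite /partial deriveM; try exact: diff_derivable.
by rewrite /GRing.scale /= addrC [g p * _]mulrC.
Qed.

Lemma smooth_on_cst U (c : R) : open U -> smooth_on U (fun=> c).
Proof.
move=> oU; apply: (@smooth_on_coind U (fun f => exists c, f = fun=> c)) => //; last by exists c.
  by move=> _ [d ->] p _; apply: differentiable_cst.
move=> _ i [d ->]; exists (fun=> 0); first by exists 0.
by move=> p _; rewrite partial_cst.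
Qed.

Lemma differentiable_add f g p : differentiable f p -> differentiable g p ->
  differentiable (fun q => f q + g q) p.
Proof. exact: differentiableD. Qed.

Lemma differentiable_mul f g p : differentiable f p -> differentiable g p ->
  differentiable (fun q => f q * g q) p.
Proof. exact: differentiableM. Qed.

Lemma smooth_onD U f g : open U -> smooth_on U f -> smooth_on U g ->
  smooth_on U (fun p => f p + g p).
Proof.
move=> oU sf sg.
apply: (@smooth_on_coind U (fun h => exists f g,
   [/\ smooth_on U f, smooth_on U g & h = fun p => f p + g p])) => //; last by exists f, g.
  move=> _ [a [b [sa sb ->]]] p Up.
  by apply: differentiable_add; [exact: smooth_on_differentiable sa Up|exact: smooth_on_differentiable sb Up].
move=> _ i [a [b [sa sb ->]]]; exists (fun p => partial i a p + partial i b p).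
  by exists (partial i a), (partial i b); split => //; apply: smooth_on_partial.
by move=> p Up; rewrite partialD //; [exact: smooth_on_differentiable sa Up|exact: smooth_on_differentiable sb Up].
Qed.

(** Products of smooth functions are not stable under partial derivatives, but
    sums of products are. *)
Inductive sum_of_products U : ('rV[R]_n -> R) -> Prop :=
| SumProdMul f g : smooth_on U f -> smooth_on U g ->
    sum_of_products U (fun p => f p * g p)
| SumProdAdd f g : sum_of_products U f -> sum_of_products U g ->
    sum_of_products U (fun p => f p + g p).

Lemma smooth_onM U f g : open U -> smooth_on U f -> smooth_on U g ->
  smooth_on U (fun p => f p * g p).
Proof.
move=> oU sf sg; have dS h p : sum_of_products U h -> U p -> differentiable h p.
  move=> Sh Up; elim: Sh => [a b sa sb|a b _ da _ db]; last exact: differentiable_add.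
  by apply: differentiable_mul; [exact: smooth_on_differentiable sa Up|exact: smooth_on_differentiable sb Up].
apply: (@smooth_on_coind U (sum_of_products U)) => //; last exact: SumProdMul.
  by move=> h Sh p; apply: dS.
move=> h i; elim=> [a b sa sb|a b Sa [a' Sa' aE] Sb [b' Sb' bE]].
  exists (fun p => partial i a p * b p + a p * partial i b p).
    by apply: SumProdAdd; apply: SumProdMul => //; apply: smooth_on_partial.
  by move=> p Up; rewrite partialM //; [exact: smooth_on_differentiable sa Up|exact: smooth_on_differentiable sb Up].
exists (fun p => a' p + b' p); first exact: SumProdAdd.
by move=> p Up; rewrite partialD ?aE ?bE //; apply: dS.
Qed.

Lemma smooth_onN U f : open U -> smooth_on U f -> smooth_on U (fun p => - f p).
Proof.
move=> oU sf; have -> : (fun p => - f p) = (fun p => -1 * f p).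
  by apply/funext => p; rewrite mulN1r.
by apply: smooth_onM => //; apply: smooth_on_cst.
Qed.

Lemma smooth_on_sum U (T : Type) (r : seq T) (P : pred T) (F : T -> 'rV[R]_n -> R) :
  open U -> (forall t, P t -> smooth_on U (F t)) ->
  smooth_on U (fun p => \sum_(t <- r | P t) F t p).
Proof.
move=> oU sF; elim: r => [|t r IH].
  apply: smooth_on_eq (smooth_on_cst 0 oU) => // p _.
  by rewrite big_nil.
have [Pt|nPt] := boolP (P t); last first.
  by apply: smooth_on_eq IH => // p _; rewrite big_cons (negbTE nPt).
apply: (@smooth_on_eq _ (fun p => F t p + \sum_(t <- r | P t) F t p)) => //.
  by move=> p _; rewrite big_cons Pt.
by apply: smooth_onD => //; apply: sF.
Qed.

Lemma smooth_on_prod U (T : Type) (r : seq T) (P : pred T) (F : T -> 'rV[R]_n -> R) :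
  open U -> (forall t, P t -> smooth_on U (F t)) ->
  smooth_on U (fun p => \prod_(t <- r | P t) F t p).
Proof.
move=> oU sF; elim: r => [|t r IH].
  apply: smooth_on_eq (smooth_on_cst 1 oU) => // p _.
  by rewrite big_nil.
have [Pt|nPt] := boolP (P t); last first.
  by apply: smooth_on_eq IH => // p _; rewrite big_cons (negbTE nPt).
apply: (@smooth_on_eq _ (fun p => F t p * \prod_(t <- r | P t) F t p)) => //.
  by move=> p _; rewrite big_cons Pt.
by apply: smooth_onM => //; apply: sF.
Qed.

Lemma differentiable_inv f p : f p != 0 -> differentiable f p ->
  differentiable (fun q => (f q)^-1) p.
Proof. by move=> fp0 df; apply: differentiableV. Qed.

Lemma partialV f i p : f p != 0 -> differentiable f p ->
  partial i (fun q => (f q)^-1) p = - partial i f p / (f p) ^+ 2.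
Proof.
move=> fp0 df; rewrite /partial deriveV //; last exact: diff_derivable.
by rewrite /GRing.scale /= mulNr mulNr mulrC.
Qed.

(** The functions h / f^m, with h smooth, are stable under partial derivatives. *)
Lemma smooth_onV U f : open U -> (forall p, U p -> f p != 0) -> smooth_on U f ->
  smooth_on U (fun p => (f p)^-1).
Proof.
move=> oU f0 sf; pose F h m p := h p * (f p)^-1 ^+ m.
have df p := @smooth_on_differentiable U f p sf.
have dX p m : U p -> differentiable (fun q => (f q)^-1 ^+ m) p.
  move=> Up; elim: m => [|m IH]; first exact: differentiable_cst.
  have -> : (fun q => (f q)^-1 ^+ m.+1) = (fun q => (f q)^-1 * (f q)^-1 ^+ m).
    by apply/funext => q; rewrite exprS.
  by apply: differentiable_mul => //; apply: differentiable_inv; [exact: f0|exact: df].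
have pX p m i : U p -> partial i (fun q => (f q)^-1 ^+ m) p =
    - m%:R * partial i f p * (f p)^-1 ^+ m.+1.
  move=> Up; elim: m => [|m IH]; first by rewrite partial_cst oppr0 !mul0r.
  have -> : (fun q => (f q)^-1 ^+ m.+1) = (fun q => (f q)^-1 * (f q)^-1 ^+ m).
    by apply/funext => q; rewrite exprS.
  rewrite partialM ?IH //; [|by apply: differentiable_inv; [exact: f0|exact: df]|exact: dX].
  rewrite partialV; [|exact: f0|exact: df].
  by rewrite -exprVn -natr1 !exprS expr0 !mulr1; ring.
apply: (@smooth_on_coind U (fun k => exists h m, smooth_on U h /\ k = F h m)) => //.
- move=> _ [h [m [sh ->]]] p Up; apply: differentiable_mul; last exact: dX.
  exact: smooth_on_differentiable sh Up.
- move=> _ i [h [m [sh ->]]].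
  pose h' p := partial i h p * f p + h p * (- m%:R * partial i f p).
  exists (F h' m.+1).
    exists h', m.+1; split => //; apply: smooth_onD => //; apply: smooth_onM => //.
      exact: smooth_on_partial.
    by apply: smooth_onM => //; [exact: smooth_on_cst|exact: smooth_on_partial].
  move=> p Up; rewrite partialM ?pX //; [|exact: smooth_on_differentiable sh Up|exact: dX].
  rewrite /F /h' mulrDl; congr (_ + _); last by rewrite !mulrA.
  by rewrite exprS -!mulrA [X in _ = _ * X]mulrA mulfV ?mul1r //; apply: f0.
- exists (fun=> 1), 1%N; split; first exact: smooth_on_cst.
  by apply/funext => p; rewrite /F mul1r expr1.
Qed.

Lemma differentiable_sqrt f p : 0 < f p -> differentiable f p ->
  differentiable (fun q => Num.sqrt (f q)) p.
Proof.
move=> fp0 df; apply: (@differentiable_comp _ _ _ _ f Num.sqrt) => //.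
by apply/derivable1_diffP; apply: (@ex_derive _ _ _ _ _ _ _ (is_derive1_sqrt fp0)).
Qed.

Lemma partial_sqrt f i p : 0 < f p -> differentiable f p ->
  partial i (fun q => Num.sqrt (f q)) p = partial i f p / (2 * Num.sqrt (f p)).
Proof.
move=> fp0 df; have ds : differentiable (Num.sqrt : R -> R) (f p).
  by apply/derivable1_diffP; apply: (@ex_derive _ _ _ _ _ _ _ (is_derive1_sqrt fp0)).
rewrite partialE; last exact: differentiable_sqrt.
rewrite (@diff_comp _ _ _ _ f Num.sqrt) //= -partialE //.
have := @derive_sqrt _ _ fp0; rewrite deriveE // => <-.
by rewrite -[in LHS](mulr1 (partial i f p)) -[partial i f p * 1]/(_ *: 1) linearZ.
Qed.

(** The functions h sqrt f, with h smooth, are stable under partial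
    derivatives. *)
Lemma smooth_on_sqrt U f : open U -> (forall p, U p -> 0 < f p) -> smooth_on U f ->
  smooth_on U (fun p => Num.sqrt (f p)).
Proof.
move=> oU f0 sf; pose F h p := h p * Num.sqrt (f p).
have df p := @smooth_on_differentiable U f p sf.
have ds p : U p -> differentiable (fun q => Num.sqrt (f q)) p.
  by move=> Up; apply: differentiable_sqrt; [exact: f0|exact: df].
apply: (@smooth_on_coind U (fun k => exists2 h, smooth_on U h & k = F h)) => //.
- move=> _ [h sh ->] p Up; apply: differentiable_mul; last exact: ds.
  exact: smooth_on_differentiable sh Up.
- move=> _ i [h sh ->].
  pose h' p := partial i h p + h p * (partial i f p * (2 * f p)^-1).
  exists (F h').
    exists h' => //; apply: smooth_onD => //; first exact: smooth_on_partial.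
    apply: smooth_onM => //; apply: smooth_onM => //; first exact: smooth_on_partial.
    apply: smooth_onV => //; last by apply: smooth_onM => //; apply: smooth_on_cst.
    by move=> p Up; rewrite mulf_neq0 ?pnatr_eq0 // gt_eqF // f0.
  move=> p Up; rewrite partialM; [|exact: smooth_on_differentiable sh Up|exact: ds].
  rewrite partial_sqrt; [|exact: f0|exact: df].
  rewrite /F /h' [RHS]mulrDl; congr (_ + _).
  have s0 : Num.sqrt (f p) != 0 by rewrite gt_eqF // sqrtr_gt0 f0.
  have fE : f p = Num.sqrt (f p) ^+ 2 by rewrite sqr_sqrtr // ltW // f0.
  set s := Num.sqrt (f p) in s0 fE *; rewrite fE; by field.
- exists (fun=> 1); first exact: smooth_on_cst.
  by apply/funext => p; rewrite /F mul1r.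
Qed.

Lemma smooth_on_det U m (A : 'rV[R]_n -> 'M[R]_m) : open U ->
  (forall a b, smooth_on U (fun p => A p a b)) -> smooth_on U (fun p => \det (A p)).
Proof.
move=> oU sA; apply: smooth_on_sum => // s _; apply: smooth_onM => //.
  exact: smooth_on_cst.
exact: smooth_on_prod.
Qed.

Lemma smooth_on_minor U (A : 'rV[R]_n -> 'M[R]_n) I J : open U ->
  (forall a b, smooth_on U (fun p => A p a b)) -> smooth_on U (fun p => minor (A p) I J).
Proof.
move=> oU sA; rewrite /minor; case: eqP => [e|_]; last exact: smooth_on_cst.
apply: smooth_on_det => // a b.
by apply: smooth_on_eq (sA _ _) => // p _; rewrite mxE.
Qed.

Lemma smooth_on_invmx U (A : 'rV[R]_n -> 'M[R]_n) a b : open U ->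
  (forall p, U p -> A p \in unitmx) ->
  (forall a b, smooth_on U (fun p => A p a b)) -> smooth_on U (fun p => invmx (A p) a b).
Proof.
move=> oU uA sA.
apply: (@smooth_on_eq _ (fun p => (\det (A p))^-1 * cofactor (A p) b a)) => //.
  by move=> p Up; rewrite /invmx uA // !mxE.
apply: smooth_onM => //.
  apply: smooth_onV => //; last exact: smooth_on_det.
  by move=> p /uA; rewrite unitmxE unitfE.
apply: smooth_onM => //; first exact: smooth_on_cst.
apply: smooth_on_det => // c d.
by apply: smooth_on_eq (sA _ _) => // p _; rewrite !mxE.
Qed.

(** * Symmetry of second derivatives and the chain rule *)

Lemma is_derive_line f a v (s : R) : differentiable f (s *: v + a) ->
  is_derive s 1 (fun s => f (s *: v + a)) ('D_v f (s *: v + a)).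
Proof.
move=> df; have E : (fun h : R => h^-1 *: (((fun s => f (s *: v + a)) \o shift s) (h *: 1) - f (s *: v + a)))
    = (fun h : R => h^-1 *: ((f \o shift (s *: v + a)) (h *: v) - f (s *: v + a))).
  apply/funext => h /=; congr (_ *: (f _ - _)).
  by rewrite [h *: 1]mulr1 scalerDl addrA.
have dv : derivable f (s *: v + a) v by exact: diff_derivable df.
by split; [rewrite /derivable E|rewrite /derive E].
Qed.

(** Mean value theorem applied to the increment s |-> f (x + s u) - f (y + s u) *)
Lemma mvt_increment f u x y (t : R) : 0 < t ->
  (forall s, 0 <= s <= t -> differentiable f (s *: u + x) /\ differentiable f (s *: u + y)) ->
  exists2 s, 0 <= s <= t &
    (f (t *: u + x) - f (t *: u + y)) - (f x - f y) =
    t * ('D_u f (s *: u + x) - 'D_u f (s *: u + y)).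
Proof.
move=> t0 df.
pose F (s : R) := f (s *: u + x) - f (s *: u + y).
pose dF (s : R) := 'D_u f (s *: u + x) - 'D_u f (s *: u + y).
have dFE s : 0 <= s <= t -> is_derive s 1 F (dF s).
  move=> /df[dx dy]; apply: is_deriveB; exact: is_derive_line.
have [s|?|s + FE] := @MVT R F dF 0 t t0.
- by rewrite in_itv /= => /andP[s0 st]; apply: dFE; rewrite !ltW.
- apply: derivable_within_continuous => s; rewrite in_itv /= => /dFE h.
  exact: ex_derive.
- rewrite in_itv /= => /andP[s0 st]; exists s; first by rewrite !ltW.
  by move: FE; rewrite /F !scale0r !add0r subr0 mulrC.
Qed.

Definition second_difference f p (u v : 'rV[R]_n) (t : R) :=
  f (t *: u + (t *: v + p)) - f (t *: u + p) - (f (t *: v + p) - f p).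

Lemma second_differenceC f p u v t :
  second_difference f p u v t = second_difference f p v u t.
Proof. by rewrite /second_difference addrCA; ring. Qed.

(** By the mean value theorem the second difference is t times an increment of
    the derivative along u, to which differentiability at p applies. *)
Lemma second_difference_approx f p u v : (\near p, differentiable f p) ->
  differentiable ('D_u f) p -> forall e : R, 0 < e ->
  \forall t \near 0^'+, `|second_difference f p u v t - t ^+ 2 * 'D_v ('D_u f) p| <= e * t ^+ 2.
Proof.
move=> ndf dg e e0; set g := 'D_u f.
(* The increments used below have norm at most t N, and the errors at two of
   them must add up to e t. *)
pose N := `|u| + `|v| + 1.
have N0 : 0 < N by rewrite ltr_wpDl.
pose e' := e / (2 * N); have e'0 : 0 < e' by rewrite divr_gt0 ?mulr_gt0.
have ng : \forall h \near (0 : 'rV[R]_n),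
    `|g (h + p) - (g p + 'd g p h)| <= e' * `|h|.
  by have /eqaddoP/(_ e' e'0) := funext (diff_locallyx dg).
have nf : \forall h \near (0 : 'rV[R]_n), differentiable f (h + p).
  by move: ndf; rewrite (near_shift 0) subr0.
have [d /= d0 dP] := iffLR (nbhs_normP _ _) (filterI nf ng).
near=> t; have t0 : 0 < t by near: t; exact: nbhs_right_gt.
have tN : t * N < d.
  by rewrite -ltr_pdivlMr //; near: t; apply: nbhs_right_lt; rewrite divr_gt0.
have bnd s w : 0 <= s <= t -> `|w| <= t * `|v| -> `|s *: u + w| <= t * N.
  move=> /andP[s0 st] wt; apply: le_trans (ler_normD _ _) _.
  rewrite normrZ ger0_norm // /N !mulrDr mulr1.
  have := ler_wpM2r (normr_ge0 u) st; lra.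
have bv : `|t *: v| <= t * `|v| by rewrite normrZ gtr0_norm.
have b0 : `|0 : 'rV[R]_n| <= t * `|v| by rewrite normr0 mulr_ge0 // ltW.
have dPt (h : 'rV[R]_n) : `|h| <= t * N ->
    differentiable f (h + p) /\ `|g (h + p) - (g p + 'd g p h)| <= e' * `|h|.
  by move=> hN; apply: dP => /=; rewrite sub0r normrN (le_lt_trans hN).
have [s st|s st E] := @mvt_increment f u (t *: v + p) p t t0.
  have [h1 _] := dPt _ (bnd s _ st bv); have [h2 _] := dPt _ (bnd s _ st b0).
  by rewrite addrA; split => //; move: h2; rewrite addr0.
have [_ ] := dPt _ (bnd s _ st bv); have [_ ] := dPt _ (bnd s _ st b0).
have := bnd s _ st bv; have := bnd s _ st b0.
rewrite addr0 /second_difference E (deriveE v dg) -/g addrA.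
set h1 := s *: u + t *: v; set h2 := s *: u => b2 b1 g2 g1.
have Lh : 'd g p h1 = 'd g p h2 + t * 'd g p v by rewrite /h1 -/h2 linearD [X in _ + X]linearZ.
rewrite (_ : _ - _ = t * ((g (h1 + p) - (g p + 'd g p h1)) - (g (h2 + p) - (g p + 'd g p h2)))); last first.
  rewrite -['D_u f (h1 + p)]/(g (h1 + p)) -['D_u f (h2 + p)]/(g (h2 + p)) Lh; ring.
rewrite normrM gtr0_norm // expr2 mulrCA ler_pM2l //.
apply: le_trans (ler_normB _ _) _; apply: le_trans (lerD g1 g2) _.
rewrite -mulrDr; apply: le_trans (ler_wpM2l (ltW e'0) (lerD b1 b2)) _.
by rewrite /e' le_eqVlt; apply/orP; left; apply/eqP; field; rewrite gt_eqF.
Unshelve. all: by end_near. Qed.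

Lemma close_quotients (s t a b e : R) : 0 < t ->
  `|s - t * a| <= e / 2 * t -> `|s - t * b| <= e / 2 * t -> `|a - b| <= e.
Proof.
move=> t0 sa sb; rewrite -(ler_pM2l t0) -{1}(gtr0_norm t0) -normrM mulrBr.
have -> : t * a - t * b = (s - t * b) - (s - t * a) by ring.
apply: le_trans (ler_normB _ _) _; have -> : t * e = e / 2 * t + e / 2 * t by field.
exact: lerD.
Qed.

(** The second difference is symmetric in the two directions, and t^2 times
    either mixed derivative approximates it up to o(t^2). *)
Lemma partialC f i j p : (\near p, differentiable f p) ->
  differentiable (partial i f) p -> differentiable (partial j f) p ->
  partial i (partial j f) p = partial j (partial i f) p.
Proof.
move=> df di dj; apply/eqP; rewrite -subr_eq0 -normr_le0; apply/ler_addgt0Pr => e e0.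
rewrite add0r distrC.
have e2 : 0 < e / 2 by rewrite divr_gt0.
have HA := @second_difference_approx f p 'e_i 'e_j df di _ e2.
have HB := @second_difference_approx f p 'e_j 'e_i df dj _ e2.
have [|t [[A B] t0]] := filter_ex (filterI (filterI HA HB) (nbhs_right_gt (0 : R))).
  exact: at_right_proper_filter.
rewrite /= second_differenceC in A B.
have t20 : 0 < t ^+ 2 by rewrite exprn_gt0.
exact: close_quotients A B.
Qed.

Lemma smooth_on_partialC U f i j p : open U -> smooth_on U f -> U p ->
  partial i (partial j f) p = partial j (partial i f) p.
Proof.
move=> oU sf Up; apply: partialC.
- by apply: near_in oU Up _ => q Uq; apply: smooth_on_differentiable sf Uq.
- exact: smooth_on_differentiable (smooth_on_partial i sf) Up.
- exact: smooth_on_differentiable (smooth_on_partial j sf) Up.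
Qed.

Lemma differentiable_rV m (F : 'rV[R]_n -> 'rV[R]_m) p :
  (forall k, differentiable (fun q => F q 0 k) p) -> differentiable F p.
Proof.
move=> dF; have -> : F = \sum_(j < m) (fun q => F q 0 j *: ('e_j : 'rV[R]_m)).
  by apply/funext => q; rewrite fct_sumE [LHS]row_sum_delta.
apply: differentiable_sum => j; exact: differentiableZl.
Qed.

Lemma jacobianE (F : 'rV[R]_n -> 'rV[R]_n) p i j :
  (forall j, differentiable (fun q => F q 0 j) p) ->
  jacobian F p i j = partial i (fun q => F q 0 j) p.
Proof.
move=> dF; have dFp := differentiable_rV dF.
have := deriveEjacobian 'e_i dFp; rewrite -rowE => /rowP/(_ j); rewrite [in RHS]mxE => <-.
rewrite derive_mx ?mxE //; exact: diff_derivable.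
Qed.

Lemma partial_comp (F : 'rV[R]_n -> 'rV[R]_n) f p i :
  (forall j, differentiable (fun q => F q 0 j) p) -> differentiable f (F p) ->
  partial i (f \o F) p = \sum_j jacobian F p i j * partial j f (F p).
Proof.
move=> dF df; have dFp := differentiable_rV dF.
rewrite partialE; last exact: differentiable_comp.
rewrite (@diff_comp _ _ _ _ F f) //= -[X in 'd f _ X]deriveE // deriveEjacobian // -rowE.
rewrite [X in 'd f _ X]row_sum_delta linear_sum; apply: eq_bigr => j _.
by rewrite linearZ mxE partialE.
Qed.

End SmoothCalculus.

(** * Smooth forms and smooth fields of endomorphisms *)

Section LocalForms.
Context {R : realType} {n : nat}.
Variable U : set 'rV[R]_n.
Hypothesis oU : open U.
Implicit Types (p q : 'rV[R]_n) (i j : 'I_n) (w : 'rV[R]_n -> exterior R n).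
Implicit Types (F : 'rV[R]_n -> exterior R n -> exterior R n).
Implicit Types (I J : {set 'I_n}).

Definition smooth_form w := forall I, smooth_on U (fun p => w p I).

Definition ext_partial i w p : exterior R n := [ffun I => partial i (fun q => w q I) p].

Lemma ext_derivE w p : ext_deriv w p = \sum_i ext_mul 'e_i (ext_partial i w p).
Proof. by []. Qed.

Lemma smooth_form_eq w w' : (forall p, U p -> w p = w' p) ->
  smooth_form w -> smooth_form w'.
Proof. by move=> ww' sw I; apply: smooth_on_eq (sw I) => // p /ww' ->. Qed.

Lemma ext_partial_eq_on w w' i : (forall p, U p -> w p = w' p) ->
  forall p, U p -> ext_partial i w p = ext_partial i w' p.
Proof.
move=> ww' p Up; apply/ffunP => I; rewrite !ffunE.
by apply: (@partial_eq_on _ _ U) => // q /ww' ->.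
Qed.

Lemma ext_deriv_eq_on w w' : (forall p, U p -> w p = w' p) ->
  forall p, U p -> ext_deriv w p = ext_deriv w' p.
Proof.
move=> ww' p Up; rewrite !ext_derivE; apply: eq_bigr => i _.
by rewrite (ext_partial_eq_on i ww').
Qed.

Lemma smooth_form_cst a : smooth_form (fun=> a).
Proof. by move=> I; apply: smooth_on_cst. Qed.

Lemma smooth_formD w w' : smooth_form w -> smooth_form w' ->
  smooth_form (fun p => w p + w' p).
Proof.
move=> sw sw' I; apply: smooth_on_eq (smooth_onD oU (sw I) (sw' I)) => // p _.
by rewrite ext_addE.
Qed.

Lemma smooth_formZ (c : 'rV[R]_n -> R) w : smooth_on U c -> smooth_form w ->
  smooth_form (fun p => c p *: w p).
Proof.
move=> sc sw I; apply: smooth_on_eq (smooth_onM oU sc (sw I)) => // p _.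
by rewrite ext_scaleE.
Qed.

Lemma smooth_form_sum (T : Type) (r : seq T) (P : pred T) (f : T -> 'rV[R]_n -> exterior R n) :
  (forall t, smooth_form (f t)) -> smooth_form (fun p => \sum_(t <- r | P t) f t p).
Proof.
move=> sf I; have := @smooth_on_sum _ _ U _ r P (fun t p => f t p I) oU (fun t _ => sf t I).
by apply: smooth_on_eq => // p _; rewrite sum_ffunE.
Qed.

Lemma smooth_form_partial i w : smooth_form w -> smooth_form (ext_partial i w).
Proof.
by move=> sw I; apply: smooth_on_eq (smooth_on_partial i (sw I)) => // p _; rewrite ffunE.
Qed.

(** Smooth fields of endomorphisms of the exterior algebra, described by what
    they do to smooth forms, so that they compose at once. *)
Definition smooth_endo F :=
  (forall p, ext_linear (F p)) /\
  (forall w, smooth_form w -> smooth_form (fun p => F p (w p))).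

Lemma endo_expand F w p : ext_linear (F p) ->
  F p (w p) = \sum_J w p J *: F p (dx J).
Proof.
move=> lF; rewrite {1}(ext_basis (w p)) ext_linear_sum //.
by apply: eq_bigr => J _; rewrite ext_linearZ.
Qed.

Lemma smooth_endo_coef F : (forall p, ext_linear (F p)) ->
  (forall I J, smooth_on U (fun p => F p (dx J) I)) -> smooth_endo F.
Proof.
move=> lF sF; split=> // w sw.
apply: (@smooth_form_eq (fun p => \sum_J w p J *: F p (dx J))).
  by move=> p _; rewrite endo_expand.
by apply: smooth_form_sum => J; apply: smooth_formZ (sw J) _ => I.
Qed.

Lemma smooth_endo_dx F I J : smooth_endo F -> smooth_on U (fun p => F p (dx J) I).
Proof. by move=> [_ sF]; apply: (sF (fun=> dx J)); apply: smooth_form_cst. Qed.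

Lemma smooth_endo_cst f : ext_linear f -> smooth_endo (fun=> f).
Proof. by move=> lf; apply: smooth_endo_coef => // I J; apply: smooth_on_cst. Qed.

Lemma smooth_endo_comp F F' : smooth_endo F -> smooth_endo F' ->
  smooth_endo (fun p a => F p (F' p a)).
Proof.
move=> [lF sF] [lF' sF']; split=> [p|w sw]; first exact: ext_linear_comp.
exact/sF/sF'.
Qed.

Lemma smooth_endoD F F' : smooth_endo F -> smooth_endo F' ->
  smooth_endo (fun p a => F p a + F' p a).
Proof.
move=> [lF sF] [lF' sF']; split=> [p|w sw]; first exact: ext_linear_add.
by apply: smooth_formD; [apply: sF|apply: sF'].
Qed.

Lemma smooth_endoZ (c : 'rV[R]_n -> R) F : smooth_on U c -> smooth_endo F ->
  smooth_endo (fun p a => c p *: F p a).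
Proof.
move=> sc [lF sF]; split=> [p|w sw]; first exact: ext_linear_scale.
by apply: smooth_formZ => //; apply: sF.
Qed.

Lemma smooth_endo_sum (T : Type) (r : seq T) (P : pred T)
    (F : T -> 'rV[R]_n -> exterior R n -> exterior R n) :
  (forall t, smooth_endo (F t)) ->
  smooth_endo (fun p a => \sum_(t <- r | P t) F t p a).
Proof.
move=> sF; split=> [p c a b|w sw].
  rewrite scaler_sumr -big_split; apply: eq_bigr => t _; exact: (sF t).1.
by apply: smooth_form_sum => t; apply: (sF t).2.
Qed.

Lemma smooth_endo_mul (u : 'rV[R]_n -> 'rV[R]_n) :
  (forall i, smooth_on U (fun p => u p 0 i)) -> smooth_endo (fun p => ext_mul (u p)).
Proof.
move=> su; apply: smooth_endo_coef => [p|I J]; first exact: ext_mul_linear.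
apply: (@smooth_on_eq _ _ _ (fun p => \sum_(i in I) sgn i (I :\ i)%SET * dx J (I :\ i)%SET * u p 0 i)) => //.
  by move=> p _; rewrite ext_mulE; apply: eq_bigr => i _; ring.
by apply: smooth_on_sum => // i _; apply: smooth_onM => //; apply: smooth_on_cst.
Qed.

Lemma smooth_endo_contraction (u : 'rV[R]_n -> 'rV[R]_n) :
  (forall i, smooth_on U (fun p => u p 0 i)) -> smooth_endo (fun p => contraction (u p)).
Proof.
move=> su; apply: smooth_endo_coef => [p|I J]; first exact: contraction_linear.
apply: (@smooth_on_eq _ _ _ (fun p => \sum_(i | i \notin I) sgn i I * dx J (i |: I)%SET * u p 0 i)) => //.
  by move=> p _; rewrite contractionE; apply: eq_bigr => i _; ring.
by apply: smooth_on_sum => // i _; apply: smooth_onM => //; apply: smooth_on_cst.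
Qed.

Lemma smooth_endo_pullback (A : 'rV[R]_n -> 'M[R]_n) :
  (forall i j, smooth_on U (fun p => A p i j)) -> smooth_endo (fun p => ext_pullback (A p)).
Proof.
move=> sA; apply: smooth_endo_coef => [p|I J]; first exact: ext_pullback_linear.
by apply: smooth_on_eq (smooth_on_minor I J oU sA) => // p _; rewrite ext_pullback_dx.
Qed.

Section MetricFields.
Variables (G : 'rV[R]_n -> 'M[R]_n) (v : 'rV[R]_n -> 'rV[R]_n).
Hypothesis sG : forall i j, smooth_on U (fun p => G p i j).
Hypothesis spdG : forall p, U p -> spd (G p).
Hypothesis sv : forall i, smooth_on U (fun p => v p 0 i).

Lemma smooth_sqrt_det : smooth_on U (fun p => Num.sqrt (\det (G p))).
Proof.
by apply: smooth_on_sqrt; rewrite //; [move=> p /spdG/spd_det|apply: smooth_on_det].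
Qed.

Lemma smooth_endo_star : smooth_endo (fun p => ext_star (G p)).
Proof.
apply: (@smooth_endoZ (fun p => Num.sqrt (\det (G p)))
  (fun p a => std_star (ext_pullback (invmx (G p)) a))); first exact: smooth_sqrt_det.
apply: (@smooth_endo_comp (fun=> std_star)).
  exact/smooth_endo_cst/std_star_linear.
apply: smooth_endo_pullback => i j; apply: smooth_on_invmx => // p /spdG.
exact: spd_unit.
Qed.

Lemma smooth_endo_star_inv : smooth_endo (fun p => ext_star_inv (G p)).
Proof.
apply: (@smooth_endoZ (fun p => (Num.sqrt (\det (G p)))^-1)
  (fun p a => ext_pullback (G p) (std_star_inv a))).
  apply: smooth_onV => //; last exact: smooth_sqrt_det.
  by move=> p /spdG/spd_det d0; rewrite gt_eqF // sqrtr_gt0.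
apply: (@smooth_endo_comp (fun p => ext_pullback (G p)) (fun=> std_star_inv)).
  exact: smooth_endo_pullback.
exact/smooth_endo_cst/std_star_inv_linear.
Qed.

Lemma smooth_flat i : smooth_on U (fun p => (v p *m G p) 0 i).
Proof.
apply: (@smooth_on_eq _ _ _ (fun p => \sum_j v p 0 j * G p j i)) => //.
  by move=> p _; rewrite mxE.
by apply: smooth_on_sum => // j _; apply: smooth_onM.
Qed.

Lemma smooth_endo_T : smooth_endo (fun p => Tmap (G p) (v p)).
Proof.
apply: (@smooth_endoD (fun=> id)); first exact: smooth_endo_cst.
apply: (@smooth_endo_comp (fun p => ext_mul (v p *m G p))).
  exact: smooth_endo_mul smooth_flat.
exact: smooth_endo_contraction.
Qed.

Lemma smooth_endo_T_inv : smooth_endo (fun p => ext_T_inv (G p) (v p)).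
Proof.
have [_ sE] : smooth_endo (fun p a => a + (- (1 + pairing (v p) (v p *m G p))^-1) *:
    ext_mul (v p *m G p) (contraction (v p) a)).
  apply: (@smooth_endoD (fun=> id)); first exact: smooth_endo_cst.
  apply: smooth_endoZ; last first.
    apply: (@smooth_endo_comp (fun p => ext_mul (v p *m G p))).
      exact: smooth_endo_mul smooth_flat.
    exact: smooth_endo_contraction.
  apply: smooth_onN => //; apply: smooth_onV => //.
    by move=> p /spdG /(pairing_spd_ge0 (v p)) h; rewrite gt_eqF // ltr_pwDl.
  apply: smooth_onD => //; first exact: smooth_on_cst.
  apply: (@smooth_on_eq _ _ _ (fun p => \sum_i v p 0 i * (v p *m G p) 0 i)) => //.
    by move=> p _; rewrite pairingE.
  by apply: smooth_on_sum => // i _; apply: smooth_onM => //; apply: smooth_flat.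
split=> [p|w sw]; first exact: ext_T_inv_linear.
by apply: smooth_form_eq (sE w sw) => p _; rewrite scaleNr.
Qed.

End MetricFields.

(** The endomorphism whose matrix is the partial derivative of that of F *)
Definition endo_partial i F p (a : exterior R n) : exterior R n :=
  \sum_J a J *: ext_partial i (fun q => F q (dx J)) p.

Lemma smooth_endo_partial i F : smooth_endo F -> smooth_endo (endo_partial i F).
Proof.
move=> sF; split=> [p c a b|w sw].
  rewrite scaler_sumr -big_split; apply: eq_bigr => J _ /=.
  by rewrite ext_addE ext_scaleE scalerDl scalerA.
apply: smooth_form_sum => J; apply: smooth_formZ => //; apply: smooth_form_partial => I.
exact: smooth_endo_dx.
Qed.

Lemma smooth_form_diff w p I : smooth_form w -> U p ->
  differentiable (fun q => w q I) p.
Proof. by move=> sw Up; apply: smooth_on_differentiable (sw I) Up. Qed.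

Lemma ext_partialD i w w' p : smooth_form w -> smooth_form w' -> U p ->
  ext_partial i (fun q => w q + w' q) p = ext_partial i w p + ext_partial i w' p.
Proof.
move=> sw sw' Up; apply/ffunP => I; rewrite ext_addE !ffunE -partialD.
- by congr (partial i _ p); apply/funext => q; rewrite ext_addE.
- exact: smooth_form_diff.
- exact: smooth_form_diff.
Qed.

Lemma ext_partialZ i (c : 'rV[R]_n -> R) w p : smooth_on U c -> smooth_form w -> U p ->
  ext_partial i (fun q => c q *: w q) p =
  partial i c p *: w p + c p *: ext_partial i w p.
Proof.
move=> sc sw Up; apply/ffunP => I; rewrite ext_addE !ext_scaleE !ffunE -partialM.
- by congr (partial i _ p); apply/funext => q; rewrite ext_scaleE.
- exact: smooth_on_differentiable sc Up.
- exact: smooth_form_diff.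
Qed.

Lemma ext_partial_sum (T : Type) (r : seq T) (f : T -> 'rV[R]_n -> exterior R n) i p :
  (forall t, smooth_form (f t)) -> U p ->
  ext_partial i (fun q => \sum_(t <- r) f t q) p = \sum_(t <- r) ext_partial i (f t) p.
Proof.
move=> sf Up; elim: r => [|t r IH].
  rewrite big_nil; apply/ffunP => I; rewrite ffunE ext_zeroE -(@partial_cst _ _ 0 i p).
  by congr (partial i _ p); apply/funext => q; rewrite big_nil ext_zeroE.
rewrite big_cons -IH -ext_partialD //; last exact: smooth_form_sum.
by apply: ext_partial_eq_on => // q _; rewrite big_cons.
Qed.

Lemma ext_partial_endo i F w p : smooth_endo F -> smooth_form w -> U p ->
  ext_partial i (fun q => F q (w q)) p =
  F p (ext_partial i w p) + endo_partial i F p (w p).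
Proof.
move=> sF sw Up; have [lF _] := sF.
have sFJ J : smooth_form (fun q => F q (dx J)) by move=> I; apply: smooth_endo_dx.
rewrite (@ext_partial_eq_on _ (fun q => \sum_J w q J *: F q (dx J))) //; last first.
  by move=> q _; rewrite endo_expand.
rewrite ext_partial_sum //; last by move=> J; apply: smooth_formZ.
rewrite endo_expand // /endo_partial -big_split; apply: eq_bigr => J _ /=.
by rewrite ext_partialZ // ffunE.
Qed.

Lemma ext_partial_linear i f w p : ext_linear f -> smooth_form w -> U p ->
  ext_partial i (fun q => f (w q)) p = f (ext_partial i w p).
Proof.
move=> lf sw Up; rewrite (ext_partial_endo i (smooth_endo_cst lf) sw Up).
rewrite [X in _ + X](_ : _ = 0) ?addr0 //; apply: big1 => J _.
rewrite (_ : ext_partial _ _ _ = 0) ?scaler0 //.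
by apply/ffunP => I; rewrite ffunE ext_zeroE partial_cst.
Qed.

(** * Operators of first and second order *)

Definition form_operator := ('rV[R]_n -> exterior R n) -> 'rV[R]_n -> exterior R n.
Implicit Types (Q P : form_operator).

(** Only the principal part C is recorded: the term of order zero does not enter
    the symbol. *)
Definition first_order Q (C : 'I_n -> 'rV[R]_n -> exterior R n -> exterior R n) :=
  (forall i, smooth_endo (C i)) /\
  exists2 C0, smooth_endo C0 & forall w, smooth_form w -> forall p, U p ->
    Q w p = \sum_i C i p (ext_partial i w p) + C0 p (w p).

(** Coefficients are allowed to differ for (i, j) and (j, i), so that no
    symmetrisation is needed when operators are composed. *)
Definition second_order P (M : 'I_n -> 'I_n -> 'rV[R]_n -> exterior R n -> exterior R n) :=
  (forall i j, smooth_endo (M i j)) /\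
  exists N L, [/\ forall i, smooth_endo (N i), smooth_endo L &
    forall w, smooth_form w -> forall p, U p ->
    P w p = \sum_i \sum_j M i j p (ext_partial i (ext_partial j w) p) +
            \sum_i N i p (ext_partial i w p) + L p (w p)].

Lemma first_order_smooth Q C w : first_order Q C -> smooth_form w -> smooth_form (Q w).
Proof.
move=> [sC [C0 sC0 QE]] sw.
apply: smooth_form_eq; first by move=> p Up; rewrite QE.
apply: smooth_formD; last exact: sC0.2.
by apply: smooth_form_sum => i; apply: (sC i).2; apply: smooth_form_partial.
Qed.

Lemma first_order_deriv : first_order ext_deriv (fun i _ => ext_mul 'e_i).
Proof.
split=> [i|]; first exact/smooth_endo_cst/ext_mul_linear.
exists (fun _ _ => 0); first by apply: smooth_endo_cst => c a b; rewrite scaler0 addr0.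
by move=> w _ p _; rewrite addr0.
Qed.

Lemma first_order_endo Q C A B : first_order Q C -> smooth_endo A -> smooth_endo B ->
  first_order (fun w p => B p (Q (fun q => A q (w q)) p))
    (fun i p a => B p (C i p (A p a))).
Proof.
move=> [sC [C0 sC0 QE]] sA sB; have [lB _] := sB.
split=> [i|].
  by apply: (smooth_endo_comp (F := B)) => //; apply: (smooth_endo_comp (F := C i)).
exists (fun p a => \sum_i B p (C i p (endo_partial i A p a)) + B p (C0 p (A p a))).
  apply: smooth_endoD.
    apply: smooth_endo_sum => i; apply: (smooth_endo_comp (F := B)) => //.
    by apply: (smooth_endo_comp (F := C i)) => //; apply: smooth_endo_partial.
  by apply: (smooth_endo_comp (F := B)) => //; apply: (smooth_endo_comp (F := C0)).
move=> w sw p Up; rewrite QE //; last exact: sA.2.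
rewrite (ext_linearD (lB p)) addrA; congr (_ + _).
rewrite (ext_linear_sum (lB p)) -big_split; apply: eq_bigr => i _ /=.
by rewrite ext_partial_endo // (ext_linearD ((sC i).1 p)) (ext_linearD (lB p)).
Qed.

Lemma second_order_comp Q C Q' C' : first_order Q C -> first_order Q' C' ->
  second_order (fun w => Q' (Q w)) (fun i j p a => C' i p (C j p a)).
Proof.
move=> hQ hQ'; have [sC [C0 sC0 QE]] := hQ; have [sC' [C0' sC0' QE']] := hQ'.
split=> [i j|]; first exact: smooth_endo_comp (sC' i) (sC j).
exists (fun j p a => \sum_i C' i p (endo_partial i (C j) p a) +
          (C' j p (C0 p a) + C0' p (C j p a))).
exists (fun p a => \sum_i C' i p (endo_partial i C0 p a) + C0' p (C0 p a)).
split=> [j||w sw p Up].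
- apply: smooth_endoD; last first.
    by apply: smooth_endoD; [exact: smooth_endo_comp (sC' j) sC0|exact: smooth_endo_comp sC0' (sC j)].
  by apply: smooth_endo_sum => i; apply: smooth_endo_comp (sC' i) (smooth_endo_partial i (sC j)).
- apply: smooth_endoD; last exact: smooth_endo_comp sC0' sC0.
  by apply: smooth_endo_sum => i; apply: smooth_endo_comp (sC' i) (smooth_endo_partial i sC0).
rewrite (QE' _ (first_order_smooth hQ sw) p Up).
have sCw j : smooth_form (fun q => C j q (ext_partial j w q)).
  exact/(sC j).2/smooth_form_partial.
have dQ i : ext_partial i (Q w) p =
    \sum_j (C j p (ext_partial i (ext_partial j w) p) + endo_partial i (C j) p (ext_partial j w p))
    + (C0 p (ext_partial i w p) + endo_partial i C0 p (w p)).
  rewrite (@ext_partial_eq_on _ _ i (QE w sw)) // ext_partialD //; last exact: sC0.2.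
    rewrite ext_partial_sum // (ext_partial_endo i sC0) //; congr (_ + _).
    apply: eq_bigr => j _; rewrite ext_partial_endo //.
    exact: smooth_form_partial.
  exact: smooth_form_sum.
under eq_bigr => i _.
  rewrite dQ (ext_linearD ((sC' i).1 p)) (ext_linear_sum ((sC' i).1 p)).
  under eq_bigr => j _ do rewrite (ext_linearD ((sC' i).1 p)).
  rewrite big_split /= (ext_linearD ((sC' i).1 p)).
  over.
rewrite QE // (ext_linearD (sC0'.1 p)) (ext_linear_sum (sC0'.1 p)).
rewrite !big_split /= [X in _ = _ + (X + _) + _]exchange_big /=.
apply/ffunP => I; rewrite !ext_addE; ring.
Qed.

Lemma second_orderD P M P' M' : second_order P M -> second_order P' M' ->
  second_order (fun w p => P w p + P' w p) (fun i j p a => M i j p a + M' i j p a).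
Proof.
move=> [sM [N [L [sN sL PE]]]] [sM' [N' [L' [sN' sL' PE']]]].
split=> [i j|]; first exact: smooth_endoD.
exists (fun i p a => N i p a + N' i p a), (fun p a => L p a + L' p a).
split=> [i||w sw p Up]; try exact: smooth_endoD.
rewrite PE // PE' //.
under [in RHS]eq_bigr => i _ do rewrite big_split.
rewrite !big_split /=; apply/ffunP => I; rewrite !ext_addE; ring.
Qed.

(** * Coefficients indexed by multi-indices *)

Section Coefficients.
Variables (k : nat) (M : 'I_n -> 'I_n -> 'rV[R]_n -> exterior R n -> exterior R n).
Variables (N : 'I_n -> 'rV[R]_n -> exterior R n -> exterior R n).
Variable (L : 'rV[R]_n -> exterior R n -> exterior R n).

Notation multi_index := {ffun 'I_n -> 'I_3}.

(** The multi-index of the derivative along i and j *)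
Definition multi_index2 i j : multi_index := [ffun l => inord ((l == i) + (l == j))%N].
Definition multi_index1 i : multi_index := [ffun l => inord (l == i)].
Definition multi_index0 : multi_index := [ffun=> ord0].

Lemma multi_index2E i j l : multi_index2 i j l = ((l == i) + (l == j))%N :> nat.
Proof. by rewrite ffunE inordK //; case: eqP; case: eqP. Qed.
Lemma multi_index1E i l : multi_index1 i l = (l == i) :> nat.
Proof. by rewrite ffunE inordK //; case: eqP. Qed.
Lemma multi_index0E l : multi_index0 l = 0%N :> nat.
Proof. by rewrite ffunE. Qed.

Lemma sum_pred1 i : (\sum_(l < n) (l == i) = 1)%N.
Proof. by rewrite (bigD1 i) //= eqxx big1 // => l /negbTE ->. Qed.

Lemma mlength2 i j : mlength (multi_index2 i j) = 2.
Proof.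
rewrite /mlength; under eq_bigr => l _ do rewrite multi_index2E.
by rewrite big_split /= !sum_pred1.
Qed.

Lemma mlength1 i : mlength (multi_index1 i) = 1%N.
Proof.
by rewrite /mlength; under eq_bigr => l _ do rewrite multi_index1E; rewrite sum_pred1.
Qed.

Lemma mlength0 : mlength multi_index0 = 0%N.
Proof. by rewrite /mlength big1 // => l _; rewrite multi_index0E. Qed.

Lemma mpower2 (x : 'rV[R]_n) i j : mpower x (multi_index2 i j) = x 0 i * x 0 j.
Proof.
rewrite /mpower; under eq_bigr => l _ do rewrite multi_index2E exprD.
rewrite big_split /=; congr (_ * _).
  by rewrite (bigD1 i) //= eqxx expr1 big1 ?mulr1 // => l /negbTE ->.
by rewrite (bigD1 j) //= eqxx expr1 big1 ?mulr1 // => l /negbTE ->.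
Qed.

(** The derivative attached to a multi-index applies the partial derivatives in
    increasing order of their indices, so only their multiset is known. *)
Lemma mpartial_perm (A : multi_index) (s : seq 'I_n) :
  (forall l, A l = count_mem l s :> nat) ->
  perm_eq (flatten [seq nseq (A i) i | i <- enum 'I_n]) s.
Proof.
move=> As; apply/allP => l _ /=; apply/eqP; rewrite count_flatten -map_comp.
rewrite sumnE big_map big_enum /= (bigD1 l) //= big1 ?addn0.
  by rewrite count_nseq /= eqxx mul1n As.
by move=> i il; rewrite count_nseq /= (negbTE il).
Qed.

Lemma mpartial0 f p : mpartial multi_index0 f p = f p.
Proof.
rewrite /mpartial (_ : flatten _ = [::]) //.
by apply/perm_nilP/mpartial_perm => l; rewrite multi_index0E.
Qed.

Lemma mpartial1 i f p : mpartial (multi_index1 i) f p = partial i f p.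
Proof.
rewrite /mpartial (_ : flatten _ = [:: i]) //.
apply/perm_small_eq => //; apply/mpartial_perm => l.
by rewrite multi_index1E /= addn0 eq_sym.
Qed.

Lemma perm_eq_pair (T : eqType) (x y : T) s :
  perm_eq s [:: x; y] -> s = [:: x; y] \/ s = [:: y; x].
Proof.
case: s => [|a [|b [|c s]]] h; try by have := perm_size h.
have := perm_mem h a; rewrite !inE eqxx /= => /esym/orP[/eqP ea|/eqP ea]; move: h; rewrite ea.
  by rewrite perm_cons => /perm_small_eq => /(_ isT)[->]; left.
rewrite perm_sym -[[:: x; y]]/([:: x] ++ [:: y]) perm_catC perm_cons.
by move=> /perm_small_eq => /(_ isT)[<-]; right.
Qed.

Lemma mpartial2 i j f p : smooth_on U f -> U p ->
  mpartial (multi_index2 i j) f p = partial i (partial j f) p.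
Proof.
move=> sf Up; rewrite /mpartial.
have [->|->] : flatten [seq nseq (multi_index2 i j l) l | l <- enum 'I_n] = [:: i; j] \/
    flatten [seq nseq (multi_index2 i j l) l | l <- enum 'I_n] = [:: j; i].
- by apply/perm_eq_pair/mpartial_perm => l; rewrite multi_index2E /= addn0 !(eq_sym l).
- by [].
- exact: smooth_on_partialC oU sf Up.
Qed.

(** The pairs (i, j) and (j, i) have the same multi-index, so the coefficients
    are sums over fibres. The sum over unit puts order zero in the same form. *)
Definition second_order_coef : @coefficients R n 2 := fun A I J p =>
  \sum_(ij : 'I_n * 'I_n | multi_index2 ij.1 ij.2 == A) M ij.1 ij.2 p (dx J) I +
  \sum_(i | multi_index1 i == A) N i p (dx J) I +
  \sum_(t : unit | multi_index0 == A) L p (dx J) I.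

Lemma sum_fiber (T : finType) (idx : T -> multi_index) (X : T -> R)
    (Y : multi_index -> R) (Q : pred multi_index) :
  \sum_(A | Q A) (\sum_(t | idx t == A) X t) * Y A =
  \sum_(t | Q (idx t)) X t * Y (idx t).
Proof.
under eq_bigr => A _ do rewrite mulr_suml.
rewrite (exchange_big_dep (fun t => Q (idx t))) /=; last by move=> A t QA /eqP ->.
by apply: eq_bigr => t Qt; rewrite (big_pred1 (idx t)) // => A; rewrite andbC /= eq_sym; case: eqP => // ->.
Qed.

Lemma sum_coef (Y : multi_index -> R) (Q : pred multi_index) I J p :
  \sum_(A | Q A) second_order_coef A I J p * Y A =
  \sum_(ij : 'I_n * 'I_n | Q (multi_index2 ij.1 ij.2))
     M ij.1 ij.2 p (dx J) I * Y (multi_index2 ij.1 ij.2) +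
  \sum_(i | Q (multi_index1 i)) N i p (dx J) I * Y (multi_index1 i) +
  \sum_(t : unit | Q multi_index0) L p (dx J) I * Y multi_index0.
Proof.
rewrite -(sum_fiber (fun ij : 'I_n * 'I_n => multi_index2 ij.1 ij.2) (fun ij => M ij.1 ij.2 p (dx J) I)).
rewrite -(sum_fiber multi_index1 (fun i => N i p (dx J) I)).
rewrite -(sum_fiber (fun _ : unit => multi_index0) (fun=> L p (dx J) I)).
by rewrite -!big_split; apply: eq_bigr => A _ /=; rewrite -!mulrDl.
Qed.

Hypotheses (sM : forall i j, smooth_endo (M i j)) (sN : forall i, smooth_endo (N i)).
Hypothesis (sL : smooth_endo L).

Lemma smooth_second_order_coef A I J : smooth_on U (second_order_coef A I J).
Proof.
apply: smooth_onD => //; last by apply: smooth_on_sum => // t _; apply: smooth_endo_dx.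
by apply: smooth_onD => //; apply: smooth_on_sum => // t _; apply: smooth_endo_dx.
Qed.

Lemma endo_coefE F a I p : smooth_endo F -> homog k a ->
  F p a I = \sum_(J : {set 'I_n} | #|J| == k) F p (dx J) I * a J.
Proof.
move=> [lF _] ka; rewrite {1}(ext_basis a) (ext_linear_sum (lF p)) sum_ffunE.
rewrite [RHS]big_mkcond; apply: eq_bigr => J _.
rewrite (ext_linearZ (lF p)) ext_scaleE mulrC; case: ifPn => // /ka ->.
by rewrite mulr0.
Qed.

Lemma homog_ext_partial i w : (forall p, U p -> homog k (w p)) ->
  forall p, U p -> homog k (ext_partial i w p).
Proof.
move=> kw p Up I cI; rewrite ffunE -(@partial_cst _ _ 0 i p).
by apply: (@partial_eq_on _ _ U) => // q Uq; apply: kw.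
Qed.

Lemma local_operatorE w p : smooth_form w -> (forall p, U p -> homog k (w p)) -> U p ->
  local_operator k second_order_coef w p =
  ext_part k (\sum_i \sum_j M i j p (ext_partial i (ext_partial j w) p) +
            \sum_i N i p (ext_partial i w p) + L p (w p)).
Proof.
move=> sw kw Up; apply/ffunP => I; rewrite !ffunE; case: ifP => // _.
rewrite exchange_big /=.
under eq_bigr => J _ do rewrite (sum_coef (fun A => mpartial A (fun q => w q J) p)).
rewrite !big_split /=; congr (_ + _ + _).
- rewrite sum_ffunE; under [RHS]eq_bigr => i _ do rewrite sum_ffunE.
  rewrite [RHS]pair_big /= [LHS](exchange_big_dep xpredT) //=; apply: eq_bigr => ij _.
  rewrite endo_coefE //; last exact: homog_ext_partial _ (homog_ext_partial _ kw) _ Up.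
  apply: eq_big => [J|J _]; first by rewrite mlength2 andbT.
  rewrite mpartial2 // !ffunE; congr (_ * partial _ _ _).
  by apply/funext => q; rewrite ffunE.
- rewrite sum_ffunE [LHS](exchange_big_dep xpredT) //=; apply: eq_bigr => i _.
  rewrite endo_coefE //; last exact: homog_ext_partial _ kw _ Up.
  apply: eq_big => [J|J _]; first by rewrite mlength1 andbT.
  by rewrite mpartial1 ffunE.
- rewrite endo_coefE //; last exact: kw.
  by apply: eq_bigr => J _; rewrite mlength0 (big_pred1 tt) ?mpartial0 //; case.
Qed.

Lemma principal_symbolE p x b : homog k b ->
  principal_symbol k second_order_coef p x b =
  ext_part k (\sum_i \sum_j (x 0 i * x 0 j) *: M i j p b).
Proof.
move=> kb; apply/ffunP => I; rewrite !ffunE; case: ifP => // _.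
rewrite exchange_big /=.
under eq_bigr => J _.
  under eq_bigr => A _ do rewrite -mulrA.
  rewrite (sum_coef (fun A => mpower x A * b J)).
  rewrite [X in _ + X + _]big1 ?addr0; last by move=> i; rewrite mlength1.
  rewrite [X in _ + X]big1 ?addr0; last by move=> i; rewrite mlength0.
  over.
rewrite sum_ffunE; under [RHS]eq_bigr => i _ do rewrite sum_ffunE.
rewrite [RHS]pair_big /= [LHS](exchange_big_dep xpredT) //=; apply: eq_bigr => ij _.
rewrite ext_scaleE endo_coefE // mulr_sumr.
apply: eq_big => [J|J _]; first by rewrite mlength2 andbT.
by rewrite mpower2; ring.
Qed.

End Coefficients.

(** A second order operator in normal form, whose values are k-forms, has
    smooth coefficients and the expected principal symbol. *)
Lemma second_order_operator k P M : second_order P M ->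
  (forall w, smooth_form w -> (forall p, U p -> homog k (w p)) ->
     forall p, U p -> homog k (P w p)) ->
  exists a : @coefficients R n 2,
   [/\ forall A I J, smooth_on U (a A I J),
       forall w, smooth_form w -> (forall p, U p -> homog k (w p)) ->
         forall p, U p -> P w p = local_operator k a w p &
       forall p x b, homog k b -> principal_symbol k a p x b =
         ext_part k (\sum_i \sum_j (x 0 i * x 0 j) *: M i j p b)].
Proof.
move=> [sM [N [L [sN sL PE]]]] kP; exists (second_order_coef M N L); split.
- exact: smooth_second_order_coef.
- move=> w sw kw p Up; rewrite local_operatorE // -PE // ext_part_homog //.
  exact: kP.
- by move=> p x b kb; rewrite principal_symbolE.
Qed.

End LocalForms.

(** * Naturality of the exterior derivative *)

Section Composition.
Context {R : realType} {n : nat}.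
Variables (U U' : set 'rV[R]_n) (tau : 'rV[R]_n -> 'rV[R]_n).
Hypotheses (oU : open U) (tauU : forall p, U p -> U' (tau p)).
Hypothesis stau : forall j, smooth_on U (fun p => tau p 0 j).
Implicit Types (p q : 'rV[R]_n) (i j : 'I_n) (w : 'rV[R]_n -> exterior R n).

Local Notation jac := (jacobian tau).

Lemma jacobian_smooth i j : smooth_on U (fun p => jac p i j).
Proof.
apply: smooth_on_eq (smooth_on_partial i (stau j)) => // p Up.
by rewrite jacobianE // => k; apply: smooth_on_differentiable (stau k) Up.
Qed.

(** By the chain rule this class is stable under partial derivatives. *)
Inductive sum_of_composites : ('rV[R]_n -> R) -> Prop :=
| CompositeMul a f : smooth_on U a -> smooth_on U' f ->
    sum_of_composites (fun p => a p * f (tau p))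
| CompositeAdd f g : sum_of_composites f -> sum_of_composites g ->
    sum_of_composites (fun p => f p + g p).

Lemma smooth_on_comp f : smooth_on U' f -> smooth_on U (f \o tau).
Proof.
move=> sf; have dtau p j : U p -> differentiable (fun q => tau q 0 j) p.
  by move=> Up; apply: smooth_on_differentiable (stau j) Up.
have dcomp h p : smooth_on U' h -> U p -> differentiable (h \o tau) p.
  move=> sh Up; apply: differentiable_comp; first by apply: differentiable_rV => j; apply: dtau.
  exact: smooth_on_differentiable sh (tauU Up).
have dS h p : sum_of_composites h -> U p -> differentiable h p.
  move=> Sh Up; elim: Sh => [a b sa sb|a b _ da _ db]; last exact: differentiable_add.
  apply: (@differentiable_mul _ _ a (b \o tau)); last exact: dcomp.
  exact: smooth_on_differentiable sa Up.
have Ssum (r : seq 'I_n) (h : 'I_n -> 'rV[R]_n -> R) : (forall j, sum_of_composites (h j)) ->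
    sum_of_composites (fun p => \sum_(j <- r) h j p).
  move=> Sh; elim: r => [|j r IH].
    rewrite (_ : (fun p => _) = fun p => 0 * f (tau p)).
      by apply: CompositeMul => //; apply: smooth_on_cst.
    by apply/funext => p; rewrite big_nil mul0r.
  rewrite (_ : (fun p => _) = fun p => h j p + \sum_(j <- r) h j p).
    exact: CompositeAdd.
  by apply/funext => p; rewrite big_cons.
apply: (@smooth_on_coind _ _ U sum_of_composites) => //; first by move=> h Sh p; apply: dS.
  move=> h i; elim=> [a b sa sb|a b Sa [a' Sa' aE] Sb [b' Sb' bE]]; last first.
    exists (fun p => a' p + b' p); first exact: CompositeAdd.
    by move=> p Up; rewrite partialD ?aE ?bE //; apply: dS.
  exists (fun p => partial i a p * b (tau p) + \sum_j (a p * jac p i j) * partial j b (tau p)).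
    apply: CompositeAdd; first by apply: CompositeMul => //; apply: smooth_on_partial.
    apply: Ssum => j; apply: (@CompositeMul (fun p => a p * jac p i j) (partial j b)).
      by apply: smooth_onM => //; apply: jacobian_smooth.
    exact: smooth_on_partial.
  move=> p Up; rewrite (@partialM _ _ a (b \o tau)); [|exact: smooth_on_differentiable sa Up|exact: dcomp].
  congr (_ + _); rewrite partial_comp; [|by move=> j; apply: dtau|exact: smooth_on_differentiable sb (tauU Up)].
  by rewrite mulr_sumr; apply: eq_bigr => j _; rewrite mulrA.
rewrite (_ : f \o tau = fun p => 1 * f (tau p)).
  by apply: CompositeMul => //; apply: smooth_on_cst.
by apply/funext => p; rewrite mul1r.
Qed.

Definition grad (f : 'rV[R]_n -> R) p : 'rV[R]_n := \row_i partial i f p.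

Lemma ext_mul_grad f p a : ext_mul (grad f p) a = \sum_i partial i f p *: ext_mul 'e_i a.
Proof.
rewrite [grad f p]rowE_sum ext_mul_suml; apply: eq_bigr => i _.
by rewrite ext_mulZl mxE.
Qed.

Lemma ext_deriv_grad w p : ext_deriv w p = \sum_J ext_mul (grad (fun q => w q J) p) (dx J).
Proof.
rewrite ext_derivE; under [RHS]eq_bigr => J _ do rewrite ext_mul_grad.
rewrite exchange_big /=; apply: eq_bigr => i _.
rewrite [ext_partial i w p]ext_basis (ext_linear_sum (ext_mul_linear _)).
by apply: eq_bigr => J _; rewrite (ext_linearZ (ext_mul_linear _)) ffunE.
Qed.

Lemma ext_deriv_sum (T : Type) (r : seq T) (f : T -> 'rV[R]_n -> exterior R n) p :
  (forall t, smooth_form U (f t)) -> U p ->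
  ext_deriv (fun q => \sum_(t <- r) f t q) p = \sum_(t <- r) ext_deriv (f t) p.
Proof.
move=> sf Up; rewrite ext_derivE; under eq_bigr => i _.
  rewrite (ext_partial_sum oU) // (ext_linear_sum (ext_mul_linear _)). over.
by rewrite exchange_big.
Qed.

Lemma ext_derivZ (c : 'rV[R]_n -> R) w p : smooth_on U c -> smooth_form U w -> U p ->
  ext_deriv (fun q => c q *: w q) p = ext_mul (grad c p) (w p) + c p *: ext_deriv w p.
Proof.
move=> sc sw Up; rewrite ext_derivE ext_mul_grad ext_derivE scaler_sumr -big_split.
apply: eq_bigr => i _ /=; rewrite (ext_partialZ i sc sw Up).
by rewrite (ext_linearD (ext_mul_linear _)) !(ext_linearZ (ext_mul_linear _)).
Qed.

Lemma ext_deriv_cst a p : ext_deriv (fun=> a) p = 0.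
Proof.
rewrite ext_derivE big1 // => i _; rewrite (_ : ext_partial _ _ _ = 0).
  exact: ext_linear0 (ext_mul_linear _).
by apply/ffunP => I; rewrite ffunE ext_zeroE partial_cst.
Qed.

(** A symmetric array contracted with an antisymmetric one *)
Lemma sum_symmetric_anti (c : 'I_n -> 'I_n -> R) a : (forall i k, c i k = c k i) ->
  \sum_k \sum_i c i k *: ext_mul 'e_i (ext_mul 'e_k a) = 0.
Proof.
move=> sc; apply/ffunP => I; rewrite ext_zeroE.
have -> : (\sum_k \sum_i c i k *: ext_mul 'e_i (ext_mul 'e_k a)) I =
    \sum_k \sum_i c i k * ext_mul 'e_i (ext_mul 'e_k a) I.
  rewrite sum_ffunE; apply: eq_bigr => k _; rewrite sum_ffunE.
  by apply: eq_bigr => i _; rewrite ext_scaleE.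
set S := \sum_k _; have : S = - S; last by lra.
rewrite {1}/S exchange_big /= -sumrN; apply: eq_bigr => i _; rewrite -sumrN.
apply: eq_bigr => k _; rewrite sc -mulrN; congr (_ * _).
by rewrite ext_mul_anti ext_oppE.
Qed.

(** d (df /\ w) = - df /\ dw, as second derivatives are symmetric *)
Lemma ext_deriv_mul_grad f w p : smooth_on U f -> smooth_form U w -> U p ->
  ext_deriv (fun q => ext_mul (grad f q) (w q)) p = - ext_mul (grad f p) (ext_deriv w p).
Proof.
move=> sf sw Up; have lm i := @ext_mul_linear R n 'e_i.
have sm i : smooth_form U (fun q => ext_mul 'e_i (w q)).
  by have [_] := smooth_endo_cst oU (lm i); apply.
rewrite (@ext_deriv_eq_on _ _ U oU _ (fun q => \sum_k partial k f q *: ext_mul 'e_k (w q))) //; last first.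
  by move=> q _; rewrite ext_mul_grad.
have sk k : smooth_form U (fun q => partial k f q *: ext_mul 'e_k (w q)).
  by apply: smooth_formZ => //; apply: smooth_on_partial.
rewrite ext_deriv_sum //.
under eq_bigr => k _.
  rewrite (ext_derivZ (smooth_on_partial k sf) (sm k) Up) ext_mul_grad.
  rewrite (_ : ext_deriv _ p = - ext_mul 'e_k (ext_deriv w p)).
    over.
  rewrite !ext_derivE (ext_linear_sum (lm k)) -sumrN; apply: eq_bigr => i _.
  by rewrite (ext_partial_linear oU i (lm k) sw Up) ext_mul_anti.
rewrite big_split /= ext_mul_grad -sumrN; under [X in _ + X]eq_bigr => k _ do rewrite scalerN.
rewrite -[RHS]add0r; congr (_ + _).
by apply: sum_symmetric_anti => i k; apply: smooth_on_partialC oU sf Up.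
Qed.

(** The pullback of dx^J is the product of the differentials of the components
    j in J of tau, each of which is closed. *)
Lemma ext_deriv_pullback_dx J p : U p ->
  ext_deriv (fun q => ext_pullback (jac q) (dx J)) p = 0.
Proof.
have sP I : smooth_form U (fun q => ext_pullback (jac q) (dx I)).
  by have [_] := smooth_endo_pullback oU jacobian_smooth; apply; apply: smooth_form_cst.
move=> Up; elim: {J}#|J| {-2}J (erefl #|J|) => [J /cards0_eq ->|k IH J cJ].
  rewrite (@ext_deriv_eq_on _ _ U oU _ (fun=> one)) ?ext_deriv_cst // => q _.
  exact: ext_pullback1.
have [j jJ] : exists j, j \in J by apply/card_gt0P; rewrite cJ.
have cJj : #|(J :\ j)%SET| = k by move: cJ; rewrite (cardsD1 j) jJ add1n => -[].
rewrite -(setD1K jJ) dx_setU1 ?inE ?eqxx //; set c := sgn _ _.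
rewrite (@ext_deriv_eq_on _ _ U oU _ (fun q => c *:
    ext_mul (grad (fun q => tau q 0 j) q) (ext_pullback (jac q) (dx (J :\ j)%SET)))) //; last first.
  move=> q Uq; rewrite (ext_linearZ (ext_pullback_linear _)) ext_pullback_mul.
  congr (_ *: ext_mul _ _); rewrite -rowE; apply/rowP => i; rewrite [LHS]mxE [LHS]mxE [RHS]mxE jacobianE //.
  by move=> l; apply: smooth_on_differentiable (stau l) Uq.
have sg : smooth_form U (fun q => ext_mul (grad (fun q => tau q 0 j) q) (ext_pullback (jac q) (dx (J :\ j)%SET))).
  have [|_] := @smooth_endo_mul _ _ U oU (grad (fun q => tau q 0 j)); last by apply.
  by move=> i; apply: smooth_on_eq (smooth_on_partial i (stau j)) => // q _; rewrite mxE.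
rewrite (ext_derivZ (smooth_on_cst c oU) sg Up) ext_deriv_mul_grad // IH //.
rewrite (ext_linear0 (ext_mul_linear _)) oppr0 scaler0 addr0.
rewrite (_ : grad _ p = 0) ?ext_mul0l //.
by apply/rowP => i; rewrite !mxE partial_cst.
Qed.

(** By the chain rule the differentials of the coefficients are natural, and
    the pulled back monomials are closed. *)
Lemma ext_deriv_pullback w p : smooth_form U' w -> U p ->
  ext_deriv (fun q => ext_pullback (jac q) (w (tau q))) p =
  ext_pullback (jac p) (ext_deriv w (tau p)).
Proof.
move=> sw Up.
have sP I : smooth_form U (fun q => ext_pullback (jac q) (dx I)).
  by have [_] := smooth_endo_pullback oU jacobian_smooth; apply; apply: smooth_form_cst.
have swt J : smooth_on U (fun q => w (tau q) J) by apply: (smooth_on_comp (sw J)).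
rewrite (@ext_deriv_eq_on _ _ U oU _ (fun q => \sum_J w (tau q) J *: ext_pullback (jac q) (dx J))) //; last first.
  by move=> q _; rewrite {1}[w (tau q)]ext_basis (ext_linear_sum (ext_pullback_linear _));
     apply: eq_bigr => J _; rewrite (ext_linearZ (ext_pullback_linear _)).
rewrite ext_deriv_sum //; last by move=> J; apply: smooth_formZ.
rewrite [ext_deriv w (tau p)]ext_deriv_grad.
rewrite [RHS](ext_linear_sum (ext_pullback_linear (jac p))).
apply: eq_bigr => J _.
rewrite ext_derivZ // ext_deriv_pullback_dx // scaler0 addr0 ext_pullback_mul.
congr ext_mul; apply/rowP => i; rewrite !mxE (@partial_comp _ _ tau (fun q => w q J)).
- by apply: eq_bigr => j _; rewrite !mxE mulrC.
- by move=> j; apply: smooth_on_differentiable (stau j) Up.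
- exact: smooth_on_differentiable (sw J) (tauU Up).
Qed.

End Composition.

(** * Forms on a manifold *)

Section Charts.
Context {R : realType} {n : nat} {M : manifold R n}.
Implicit Types (c : chart R n M) (p : 'rV[R]_n).

Lemma chart_open c : open (ccod c).
Proof. exact: ccod_open. Qed.

Lemma overlap_open c c' : open (overlap c c').
Proof.
rewrite openE => p [cp cp']; apply: filterI.
  by apply: open_nbhs_nbhs; split => //; apply: ccod_open.
have pc : {in ccod c, continuous (param c)}.
  by rewrite -continuous_open_subspace; [exact: param_continuous|exact: ccod_open].
have := pc p (mem_set cp); apply; apply: open_nbhs_nbhs; split => //.
exact: cdom_open.
Qed.

Lemma transition_in c c' p : overlap c c' p -> ccod c' (transition c c' p).
Proof. by move=> [_ cp']; apply: coord_in. Qed.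

Lemma overlap_sub c c' p : overlap c c' p -> ccod c p.
Proof. by case. Qed.

(** Smooth differential forms of mixed degree, so that all operators act on the
    same objects and degrees are treated separately *)
Definition form_field (w : chart_family (M := M) (exterior R n)) :=
  (forall c, atlas c -> smooth_form (ccod c) (w c)) /\
  (forall c c', atlas c -> atlas c' -> forall p, overlap c c' p ->
     w c p = ext_pullback (jacobian (transition c c') p) (w c' (transition c c' p))).

Lemma OmegaE k w : Omega k w <->
  form_field w /\ forall c, atlas c -> forall p, ccod c p -> homog k (w c p).
Proof.
split=> [[sw kw tw]|[[sw tw] kw]]; first by split; [split|].
by split.
Qed.

Lemma form_field_eq w w' :
  (forall c, atlas c -> forall p, ccod c p -> w c p = w' c p) ->
  form_field w -> form_field w'.
Proof.
move=> ww' [sw tw]; split=> [c ac|c c' ac ac' p cp].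
  by apply: smooth_form_eq (sw c ac); [exact: ccod_open|move=> p cp; rewrite ww'].
rewrite -!ww' //; first exact: tw; first exact: transition_in cp.
exact: overlap_sub cp.
Qed.

Lemma form_fieldD w w' : form_field w -> form_field w' ->
  form_field (fun c p => w c p + w' c p).
Proof.
move=> [sw tw] [sw' tw']; split=> [c ac|c c' ac ac' p cp].
  by apply: smooth_formD; [exact: ccod_open|exact: sw|exact: sw'].
by rewrite (tw c c') // (tw' c c') // (ext_linearD (ext_pullback_linear _)).
Qed.

Lemma form_field_endo (F : chart_family (M := M) (exterior R n -> exterior R n)) w :
  (forall c, atlas c -> smooth_endo (ccod c) (F c)) ->
  (forall c c', atlas c -> atlas c' -> forall p, overlap c c' p -> forall a,
     F c p (ext_pullback (jacobian (transition c c') p) a) =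
     ext_pullback (jacobian (transition c c') p) (F c' (transition c c' p) a)) ->
  form_field w -> form_field (fun c p => F c p (w c p)).
Proof.
move=> sF tF [sw tw]; split=> [c ac|c c' ac ac' p cp].
  by have [_] := sF c ac; apply; apply: sw.
by rewrite (tw c c') // tF.
Qed.

Lemma form_fieldZ (a : R) w : form_field w -> form_field (fun c p => a *: w c p).
Proof.
apply: (@form_field_endo (fun c p b => a *: b)) => [c ac|c c' _ _ p _ b].
  apply: smooth_endo_cst; first exact: ccod_open.
  by move=> d b b'; rewrite scalerDr !scalerA mulrC.
by rewrite (ext_linearZ (ext_pullback_linear _)).
Qed.

Lemma transition_smooth c c' j : atlas c -> atlas c' ->
  smooth_on (overlap c c') (fun p => transition c c' p 0 j).
Proof. by move=> ac ac'; apply: atlas_smooth. Qed.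

Lemma form_field_deriv w : form_field w -> form_field (ext_d w).
Proof.
move=> [sw tw]; split=> [c ac|c c' ac ac' p cp].
  have h1 := @first_order_smooth _ _ _ (@chart_open c).
  have h2 := first_order_deriv (@chart_open c).
  exact: (h1 _ _ _ h2 (sw c ac)).
have oV := @overlap_open c c'.
rewrite /ext_d -(@ext_deriv_pullback _ _ _ (ccod c') _ oV) //; last 3 first.
- by move=> q; apply: transition_in.
- by move=> j; apply: transition_smooth.
- exact: sw.
by apply: (ext_deriv_eq_on oV) cp => q cq; apply: tw.
Qed.

Variables (g : chart_family (M := M) 'M[R]_n) (v : chart_family (M := M) 'rV[R]_n).
Hypotheses (orM : oriented M) (gM : riemannian_metric g) (vM : vector_field v).

Lemma metric_spd c p : atlas c -> ccod c p -> spd (g c p).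
Proof. by move=> ac cp; have [_ /(_ c ac p cp)[]] := gM. Qed.

Lemma metric_smooth c i j : atlas c -> smooth_on (ccod c) (fun p => g c p i j).
Proof. by move=> ac; have [h _ _] := gM; apply: h. Qed.

Lemma vector_smooth c i : atlas c -> smooth_on (ccod c) (fun p => v c p 0 i).
Proof. by move=> ac; have [h _] := vM; apply: h. Qed.

Lemma metric_transition c c' p : atlas c -> atlas c' -> overlap c c' p ->
  g c p = jacobian (transition c c') p *m g c' (transition c c' p)
          *m (jacobian (transition c c') p)^T.
Proof. by move=> ac ac' cp; have [_ _] := gM; apply. Qed.

Lemma vector_transition c c' p : atlas c -> atlas c' -> overlap c c' p ->
  v c' (transition c c' p) = v c p *m jacobian (transition c c') p.
Proof. by move=> ac ac' cp; have [_] := vM; apply. Qed.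

Lemma form_field_star w : form_field w -> form_field (star g w).
Proof.
move=> fw; apply: (@form_field_eq (fun c p => ext_star (g c p) (w c p))).
  by move=> c _ p _; rewrite /star hodgeE.
apply: (form_field_endo (F := fun c p => ext_star (g c p))) fw => [c ac|c c' ac ac' p cp a].
  by apply: (@smooth_endo_star _ _ _ (@chart_open c) (g c)) => *; [exact: metric_smooth|exact: metric_spd].
apply: ext_star_pullback; rewrite ?orM //; last exact: metric_transition.
exact: metric_spd (transition_in cp).
Qed.

Lemma form_field_star_inv w : form_field w -> form_field (star_inv g w).
Proof.
move=> fw; apply: (@form_field_eq (fun c p => ext_star_inv (g c p) (w c p))).
  by move=> c ac p cp; rewrite /star_inv hodge_invE //; apply: metric_spd.
apply: (form_field_endo (F := fun c p => ext_star_inv (g c p))) fw => [c ac|c c' ac ac' p cp a].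
  by apply: (@smooth_endo_star_inv _ _ _ (@chart_open c) (g c)) => *; [exact: metric_smooth|exact: metric_spd].
apply: ext_star_inv_pullback; rewrite ?orM //; last exact: metric_transition.
- exact: metric_spd (overlap_sub cp).
- exact: metric_spd (transition_in cp).
Qed.

Lemma form_field_T w : form_field w -> form_field (Tfield g v w).
Proof.
apply: (form_field_endo (F := fun c p => Tmap (g c p) (v c p))) => [c ac|c c' ac ac' p cp a].
  by apply: (@smooth_endo_T _ _ _ (@chart_open c) (g c) (v c)) => *; [exact: metric_smooth|exact: vector_smooth].
by apply: Tmap_pullback; [exact: metric_transition|exact: vector_transition].
Qed.

Lemma form_field_T_inv w : form_field w -> form_field (Tfield_inv g v w).
Proof.
move=> fw; apply: (@form_field_eq (fun c p => ext_T_inv (g c p) (v c p) (w c p))).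
  by move=> c ac p cp; rewrite /Tfield_inv Tmap_invE //; apply: metric_spd.
apply: (form_field_endo (F := fun c p => ext_T_inv (g c p) (v c p))) fw => [c ac|c c' ac ac' p cp a].
  by apply: (@smooth_endo_T_inv _ _ _ (@chart_open c) (g c) (v c)) => *; [exact: metric_smooth|exact: metric_spd|exact: vector_smooth].
apply: ext_T_inv_pullback; [| |exact: metric_transition|exact: vector_transition].
- exact: metric_spd (overlap_sub cp).
- exact: metric_spd (transition_in cp).
Qed.

Lemma form_field_codiff k w : form_field w -> form_field (codiff_v g v k w).
Proof.
move=> fw; apply: form_field_T_inv; apply: form_fieldZ; apply: form_field_star_inv.
exact/form_field_deriv/form_field_star/form_field_T.
Qed.

Lemma form_field_laplacian k w : form_field w -> form_field (laplacian_v g v k w).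
Proof.
move=> fw; apply: form_fieldD; first exact/form_field_deriv/form_field_codiff.
exact/form_field_codiff/form_field_deriv.
Qed.

(** * The Laplacian in a chart *)

Definition chart_codiff c k (w : 'rV[R]_n -> exterior R n) p : exterior R n :=
  (-1) ^+ k *: ext_T_inv (g c p) (v c p) (ext_star_inv (g c p)
    (ext_deriv (fun q => ext_star (g c q) (Tmap (g c q) (v c q) (w q))) p)).

Lemma codiff_chart c k w p : atlas c -> ccod c p ->
  codiff_v g v k w c p = chart_codiff c k (w c) p.
Proof.
move=> ac cp; have Gspd := metric_spd ac cp.
rewrite /codiff_v /Tfield_inv (Tmap_invE _ _ Gspd) /codiff (ext_linearZ (ext_T_inv_linear _ _)).
rewrite /star_inv (hodge_invE _ Gspd) /ext_d /chart_codiff.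
have -> : star g (Tfield g v w) c = fun q => ext_star (g c q) (Tmap (g c q) (v c q) (w c q)).
  by apply/funext => q; rewrite /star hodgeE.
by [].
Qed.

Lemma first_order_codiff c k : atlas c ->
  first_order (ccod c) (chart_codiff c k)
    (fun i p => codiff_symbol (g c p) (v c p) 'e_i k).
Proof.
move=> ac; have oU := @chart_open c.
have sG i j := metric_smooth i j ac; have sV i := vector_smooth i ac.
have Gspd p := @metric_spd c p ac.
have sA : smooth_endo (ccod c) (fun p a => ext_star (g c p) (Tmap (g c p) (v c p) a)).
  apply: (smooth_endo_comp (F := fun p => ext_star (g c p))).
    exact: (smooth_endo_star oU sG Gspd).
  exact: (smooth_endo_T oU sG sV).
have sB : smooth_endo (ccod c)
    (fun p a => (-1) ^+ k *: ext_T_inv (g c p) (v c p) (ext_star_inv (g c p) a)).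
  apply: (@smooth_endoZ _ _ _ oU (fun=> (-1) ^+ k)); first exact: smooth_on_cst.
  apply: (smooth_endo_comp (F := fun p => ext_T_inv (g c p) (v c p))).
    exact: (smooth_endo_T_inv oU sG Gspd sV).
  exact: (smooth_endo_star_inv oU sG Gspd).
exact: (first_order_endo oU (first_order_deriv oU) sA sB).
Qed.

Definition chart_laplacian c k (w : 'rV[R]_n -> exterior R n) p : exterior R n :=
  ext_deriv (chart_codiff c k w) p + chart_codiff c k.+1 (ext_deriv w) p.

Lemma laplacian_chart c k w p : atlas c -> ccod c p ->
  laplacian_v g v k w c p = chart_laplacian c k (w c) p.
Proof.
move=> ac cp; rewrite /laplacian_v codiff_chart //; congr (_ + _).
by apply: (ext_deriv_eq_on (@chart_open c)) cp => q cq; rewrite codiff_chart.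
Qed.

Lemma second_order_laplacian c k : atlas c ->
  second_order (ccod c) (chart_laplacian c k)
    (fun i j p a => ext_mul 'e_i (codiff_symbol (g c p) (v c p) 'e_j k a) +
                    codiff_symbol (g c p) (v c p) 'e_i k.+1 (ext_mul 'e_j a)).
Proof.
move=> ac; have oU := @chart_open c; have d1 := first_order_deriv oU.
apply: (second_orderD oU).
  exact: (second_order_comp oU (first_order_codiff k ac) d1).
exact: (second_order_comp oU d1 (first_order_codiff k.+1 ac)).
Qed.

Lemma ext_mul_row (x : 'rV[R]_n) a : ext_mul x a = \sum_i x 0 i *: ext_mul 'e_i a.
Proof.
rewrite {1}(rowE_sum x) ext_mul_suml; apply: eq_bigr => i _.
by rewrite ext_mulZl.
Qed.

Lemma codiff_symbol_row (G : 'M[R]_n) (u x : 'rV[R]_n) k a :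
  codiff_symbol G u x k a = \sum_i x 0 i *: codiff_symbol G u 'e_i k a.
Proof.
rewrite /codiff_symbol ext_mul_row (ext_linear_sum (ext_star_inv_linear G)).
rewrite (ext_linear_sum (ext_T_inv_linear G u)) scaler_sumr; apply: eq_bigr => i _.
rewrite (ext_linearZ (ext_star_inv_linear G)) (ext_linearZ (ext_T_inv_linear G u)).
by rewrite !scalerA mulrC.
Qed.

(** Symbols are linear in the covector, so that they are determined by the
    coordinate covectors. *)
Lemma row_expand_comp (F F' : 'rV[R]_n -> exterior R n -> exterior R n) x a :
  (forall y b, F y b = \sum_i y 0 i *: F 'e_i b) ->
  (forall y b, F' y b = \sum_i y 0 i *: F' 'e_i b) ->
  (forall i, ext_linear (F 'e_i)) ->
  F x (F' x a) = \sum_i \sum_j (x 0 i * x 0 j) *: F 'e_i (F' 'e_j a).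
Proof.
move=> FE FE' lF; rewrite FE; apply: eq_bigr => i _.
rewrite FE' (ext_linear_sum (lF i)) scaler_sumr; apply: eq_bigr => j _.
by rewrite (ext_linearZ (lF i)) scalerA.
Qed.

Lemma laplacian_symbolE c k p (x : 'rV[R]_n) a :
  \sum_i \sum_j (x 0 i * x 0 j) *:
    (ext_mul 'e_i (codiff_symbol (g c p) (v c p) 'e_j k a) +
     codiff_symbol (g c p) (v c p) 'e_i k.+1 (ext_mul 'e_j a)) =
  laplacian_symbol (g c p) (v c p) x k a.
Proof.
set G := g c p; set u := v c p.
rewrite /laplacian_symbol (row_expand_comp (F := ext_mul) (F' := fun y => codiff_symbol G u y k)).
- rewrite (row_expand_comp (F := fun y => codiff_symbol G u y k.+1) (F' := ext_mul)).
  + rewrite -big_split; apply: eq_bigr => i _ /=; rewrite -big_split.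
    by apply: eq_bigr => j _ /=; rewrite scalerDr.
  + by move=> y b; apply: codiff_symbol_row.
  + by move=> y b; apply: ext_mul_row.
  + by move=> i; apply: codiff_symbol_linear.
- by move=> y b; apply: ext_mul_row.
- by move=> y b; apply: codiff_symbol_row.
- by move=> i; apply: ext_mul_linear.
Qed.

(** The star of a k-form has degree n - k, its differential n - k + 1, and the
    inverse star brings this to k - 1. *)
Lemma prehomog_codiff c k w : atlas c -> (forall p, ccod c p -> homog k (w p)) ->
  forall p, ccod c p -> prehomog k (chart_codiff c k w p).
Proof.
move=> ac kw p cp; apply/prehomogZ/prehomog_T_inv/prehomog_star_inv => I cI.
rewrite ext_derivE sum_ffunE big1 // => i _.
apply: (@cohomog_mul _ _ k) cI => J cJ; rewrite ffunE -(@partial_cst _ _ 0 i p).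
apply: (@partial_eq_on _ _ (ccod c)) cp => [|q cq]; first exact: chart_open.
by apply: cohomog_star cJ; apply/homog_T/kw.
Qed.

Lemma homog_deriv c k w : (forall p, ccod c p -> homog k (w p)) ->
  forall p, ccod c p -> homog k.+1 (ext_deriv w p).
Proof.
move=> kw p cp I cI; rewrite ext_derivE sum_ffunE big1 // => i _.
by apply: homog_mul cI; apply: homog_ext_partial kw _ cp; apply: chart_open.
Qed.

Lemma homog_deriv_prehomog c k w : (forall p, ccod c p -> prehomog k (w p)) ->
  forall p, ccod c p -> homog k (ext_deriv w p).
Proof.
case: k => [|k] kw p cp.
  rewrite (@ext_deriv_eq_on _ _ (ccod c) (@chart_open c) _ (fun=> 0)) //.
    by rewrite ext_deriv_cst; apply: homog0.
  by move=> q /kw /prehomog0.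
by apply: homog_deriv cp => q /kw /prehomog_homog.
Qed.

Lemma homog_laplacian c k w : atlas c -> (forall p, ccod c p -> homog k (w p)) ->
  forall p, ccod c p -> homog k (chart_laplacian c k w p).
Proof.
move=> ac kw p cp; apply: homogD.
  by apply: homog_deriv_prehomog cp => q; apply: prehomog_codiff.
apply: (prehomog_homog (k := k.+1)); apply: prehomog_codiff cp => // q.
exact: homog_deriv.
Qed.

Lemma elliptic_laplacian k : elliptic k 2 (laplacian_v g v k).
Proof.
split=> [w /OmegaE[fw kw]|c ac].
  apply/OmegaE; split=> [|c ac p cp]; first exact: form_field_laplacian.
  by rewrite laplacian_chart //; apply: homog_laplacian cp => // q; apply: kw.
have oU := @chart_open c.
have [a [sa aE symE]] := second_order_operator oU (k := k) (second_order_laplacian k ac)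
  (fun w _ kw => homog_laplacian ac kw).
exists a; split=> // [w /OmegaE[[sw tw] kw] p cp|p cp x x0].
  rewrite laplacian_chart // aE //; first exact: sw.
  by move=> q; apply: kw.
have symbolE : {in homog k, principal_symbol k a p x =1
    laplacian_symbol (g c p) (v c p) x k}.
  move=> b /set_mem kb; rewrite symE // laplacian_symbolE ext_part_homog //.
  have [h _ _] := laplacian_symbol_bij (v c p) k (metric_spd ac cp) x0.
  exact: h.
have := laplacian_symbol_bij (v c p) k (metric_spd ac cp) x0.
move=> [h1 h2 h3]; split.
- by move=> b kb; rewrite (symbolE b (mem_set kb)); exact: (h1 b kb).
- by move=> b b' kb kb'; rewrite (symbolE b kb) (symbolE b' kb'); exact: (h2 b b' kb kb').
- move=> b kb; have [b' kb' <-] := h3 b kb.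
  by exists b'; rewrite // (symbolE b' (mem_set kb')).
Qed.

End Charts.

Theorem theorem3p1 (R : realType) (n : nat) (M : manifold R n)
    (g : chart_family (M := M) 'M[R]_n) (v : chart_family (M := M) 'rV[R]_n) :
  compact [set: M] -> oriented M -> riemannian_metric g -> vector_field v ->
  forall k : nat, elliptic k 2 (laplacian_v g v k).
Proof. by move=> _ orM gM vM k; apply: elliptic_laplacian. Qed.
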